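(* Let $F$ be a field of characteristic zero with $\sqrt{-1}\in F$. The Lie superalgebra $L=K^{(2)}(F[t,t^{-1}]:2)$ of Ramond type is presented by the generators $$t^2,\ t^{-2},\ t^4,\ t^{-4},\ \xi_1,\ t\xi_2,\ t\xi_1\xi_2,\ t^{-1}\xi_1\xi_2$$ and relations of degree $\le5$. That is, if $\varphi:\mathrm{Lie}\langle x_1,\dots,x_8\rangle\to L$ is the homomorphism from the free Lie superalgebra (with parities of $x_1,\dots,x_8$ matching those of the generators) sending $x_1,\dots,x_8$ to these elements, then $\varphi$ is surjective and $\ker\varphi$ is generated as an ideal by its elements of degree $\le5$.
   Context: $G(2)$ is the Grassmann algebra over $F$ on odd generators $\xi_1,\xi_2$, $\mathbb Z$-graded with $\deg\xi_i=1$, with bracket $\{f,g\}=(-1)^{|f|}\sum_i\frac{\partial f}{\partial\xi_i}\frac{\partial g}{\partial\xi_i}$ ($|f|$ is the parity). $A=F[t,t^{-1}]$ (purely even) carries the bracket $[t^i,t^j]=(i-j)t^{i+j}$, and $D(a)=[a,1]$, i.e. $D=t\frac{d}{dt}$. $K(A:2)$ is $A\otimes_FG(2)$ with Lie superbracket $$[a_1b_1,a_2b_2]=[a_1,a_2]b_1b_2+a_1a_2\{b_1,b_2\}+\tfrac12\big(\deg(b_1)a_1D(a_2)-\deg(b_2)D(a_1)a_2\big)b_1b_2,\quad a_i\in A,\ b_i\in G(2).$$ $K^{(2)}(A:2)$ is the Lie subsuperalgebra $F[t^2,t^{-2}]\otimes\operatorname{Span}(1,\xi_1)+tF[t^2,t^{-2}]\otimes\operatorname{Span}(\xi_2,\xi_1\xi_2)$.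 An element of the free Lie superalgebra on $x_1,\dots,x_8$ has degree $\le n$ if it is a linear combination of commutators in $x_1,\dots,x_8$ of length $\le n$. *)

(* Defs.v *)
From HB Require Import structures.
From mathcomp Require Import all_boot all_order all_algebra generic_quotient.
From mathcomp Require Import finmap boolp monalg ring zify.

Set Implicit Arguments.
Unset Strict Implicit.
Unset Printing Implicit Defensive.

Import GRing.Theory.
Local Open Scope ring_scope.
Local Open Scope quotient_scope.

(* [homog p x] means that x lies in the component of parity p, with [false]
   the even and [true] the odd one.  These axioms are the right ones away from
   characteristics 2 and 3. *)
HB.mixin Record Lmodule_isLieSuper (F : fieldType) L of GRing.Lmodule F L := {
  homog : bool -> L -> Prop;
  lbr : L -> L -> L;
  homog_lin : forall p (c : F) x y, homog p x -> homog p y ->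
    homog p (c *: x + y);
  homog_dec : forall x, exists x0 x1,
    [/\ homog false x0, homog true x1 & x = x0 + x1];
  homog_dir : forall x, homog false x -> homog true x -> x = 0;
  lbr_linl : forall (c : F) x y z,
    lbr (c *: x + y) z = c *: lbr x z + lbr y z;
  lbr_linr : forall (c : F) z x y,
    lbr z (c *: x + y) = c *: lbr z x + lbr z y;
  homog_lbr : forall p q x y, homog p x -> homog q y ->
    homog (p (+) q) (lbr x y);
  lbr_skew : forall p q x y, homog p x -> homog q y ->
    lbr x y = - ((-1) ^+ (p && q) *: lbr y x);
  lbr_jacobi : forall p q x y z, homog p x -> homog q y ->
    lbr x (lbr y z) = lbr (lbr x y) z + (-1) ^+ (p && q) *: lbr y (lbr x z)
}.

#[short(type="lieSuperType")]
HB.structure Definition LieSuper (F : fieldType) :=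
  { L of GRing.Lmodule F L & Lmodule_isLieSuper F L }.

Section LieSuperNotions.
Variables (F : fieldType).

Definition ls_morphism (L M : lieSuperType F) (phi : L -> M) :=
  (forall x y, phi (lbr x y) = lbr (phi x) (phi y)) /\
  (forall p x, homog p x -> homog p (phi x)).

Variable L : lieSuperType F.

(* Ideals are not required to be graded.  An ideal generated by a set that is
   stable under taking homogeneous components is graded anyway, and the kernel
   of a morphism cut at a given degree is such a set. *)
Definition ls_ideal (I : L -> Prop) :=
  [/\ I 0,
      forall (c : F) x y, I x -> I y -> I (c *: x + y),
      forall x y, I y -> I (lbr x y) &
      forall x y, I x -> I (lbr x y)].

Definition ideal_gen (S : L -> Prop) (x : L) :=
  forall I, ls_ideal I -> (forall y, S y -> I y) -> I x.

Variables (X : Type) (x : X -> L).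

(* Arbitrarily bracketed commutators in the family x, indexed by length *)
Inductive commutator : nat -> L -> Prop :=
| commutator_gen j : commutator 1 (x j)
| commutator_lbr k l u v : commutator k u -> commutator l v ->
    commutator (k + l)%N (lbr u v).

Definition degree_le (n : nat) (u : L) :=
  exists (m : nat) (c : 'I_m -> F) (w : 'I_m -> L),
    (forall i, exists2 k, (k <= n)%N & commutator k (w i)) /\
    u = \sum_i c i *: w i.

End LieSuperNotions.

(* The free Lie superalgebra: formal expressions in the generators modulo the
   least congruence imposing the axioms.  See [freeLS_lift] and
   [freeLS_unique] below for its universal property. *)
Inductive lterm (F X : Type) :=
| TGen of X
| TZero
| TAdd of lterm F X & lterm F X
| TScale of F & lterm F X
| TBr of lterm F X & lterm F X.

Arguments TGen {F X}.
Arguments TZero {F X}.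

HB.instance Definition _ F X := gen_eqMixin (lterm F X).
HB.instance Definition _ F X := gen_choiceMixin (lterm F X).

Section Free.
Variables (F : fieldType) (X : Type) (par : X -> bool).

Local Notation term := (lterm F X).
Implicit Types (a b c d : term) (s t : F).

Inductive thomog : bool -> term -> Prop :=
| thomog_gen j : thomog (par j) (TGen j)
| thomog_zero p : thomog p TZero
| thomog_add p a b : thomog p a -> thomog p b -> thomog p (TAdd a b)
| thomog_scale p s a : thomog p a -> thomog p (TScale s a)
| thomog_br p q a b : thomog p a -> thomog q b -> thomog (p (+) q) (TBr a b).

Inductive teq : term -> term -> Prop :=
| teq_refl a : teq a a
| teq_sym a b : teq a b -> teq b a
| teq_trans a b c : teq a b -> teq b c -> teq a c
| teq_add a b c d : teq a b -> teq c d -> teq (TAdd a c) (TAdd b d)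
| teq_scale s a b : teq a b -> teq (TScale s a) (TScale s b)
| teq_br a b c d : teq a b -> teq c d -> teq (TBr a c) (TBr b d)
| teq_addA a b c : teq (TAdd a (TAdd b c)) (TAdd (TAdd a b) c)
| teq_addC a b : teq (TAdd a b) (TAdd b a)
| teq_add0 a : teq (TAdd TZero a) a
| teq_scale0 a : teq (TScale 0 a) TZero
| teq_scale1 a : teq (TScale 1 a) a
| teq_scaleA s t a : teq (TScale s (TScale t a)) (TScale (s * t) a)
| teq_scaleDr s a b : teq (TScale s (TAdd a b)) (TAdd (TScale s a) (TScale s b))
| teq_scaleDl s t a : teq (TScale (s + t) a) (TAdd (TScale s a) (TScale t a))
| teq_brDl a b c : teq (TBr (TAdd a b) c) (TAdd (TBr a c) (TBr b c))
| teq_brDr a b c : teq (TBr c (TAdd a b)) (TAdd (TBr c a) (TBr c b))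
| teq_brZl s a b : teq (TBr (TScale s a) b) (TScale s (TBr a b))
| teq_brZr s a b : teq (TBr a (TScale s b)) (TScale s (TBr a b))
| teq_skew p q a b : thomog p a -> thomog q b ->
    teq (TBr a b) (TScale (- (-1) ^+ (p && q)) (TBr b a))
| teq_jacobi p q r a b c : thomog p a -> thomog q b -> thomog r c ->
    teq (TBr a (TBr b c))
        (TAdd (TBr (TBr a b) c) (TScale ((-1) ^+ (p && q)) (TBr b (TBr a c)))).

Definition teqb a b := `[< teq a b >].

Lemma teqb_equiv : equiv_class_of teqb.
Proof.
split=> [a|a b|b a c].
- by apply/asboolP; apply: teq_refl.
- by apply/asboolP/asboolP; apply: teq_sym.
- by move=> /asboolP ab /asboolP bc; apply/asboolP; apply: teq_trans bc.
Qed.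

Canonical teqb_equiv_rel := EquivRelPack teqb_equiv.

Definition freeLS := {eq_quot teqb_equiv_rel}.

HB.instance Definition _ := Choice.on freeLS.
HB.instance Definition _ := Quotient.on freeLS.

Local Notation cl := (\pi_freeLS).

Definition fgen (j : X) : freeLS := cl (TGen j).

Let fzero : freeLS := cl TZero.
Let fadd (u v : freeLS) : freeLS := cl (TAdd (repr u) (repr v)).
Let fscale s (u : freeLS) : freeLS := cl (TScale s (repr u)).
Let fbr (u v : freeLS) : freeLS := cl (TBr (repr u) (repr v)).

Let clE a b : teq a b -> cl a = cl b.
Proof. by move=> ab; apply/eqmodP/asboolP. Qed.

Let clP a b : cl a = cl b -> teq a b.
Proof. by move/eqmodP/asboolP. Qed.

Let clind (P : freeLS -> Prop) : (forall a, P (cl a)) -> forall u, P u.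
Proof. by move=> h u; rewrite -[u]reprK. Qed.

Let reprT a : teq (repr (cl a)) a.
Proof. by apply: clP; rewrite reprK. Qed.

Let faddE a b : fadd (cl a) (cl b) = cl (TAdd a b).
Proof. by apply: clE; apply: teq_add; apply: reprT. Qed.
Let fscaleE s a : fscale s (cl a) = cl (TScale s a).
Proof. by apply: clE; apply: teq_scale; apply: reprT. Qed.
Let fbrE a b : fbr (cl a) (cl b) = cl (TBr a b).
Proof. by apply: clE; apply: teq_br; apply: reprT. Qed.

Let faddA : associative fadd.
Proof.
elim/clind=> a; elim/clind=> b; elim/clind=> c; rewrite !faddE.
apply: clE; apply: teq_addA.
Qed.
Let faddC : commutative fadd.
Proof. by elim/clind=> a; elim/clind=> b; rewrite !faddE; apply: clE; apply: teq_addC. Qed.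
Let fadd0 : left_id fzero fadd.
Proof. by elim/clind=> a; rewrite faddE; apply: clE; apply: teq_add0. Qed.
Let faddN : left_inverse fzero (fscale (-1)) fadd.
Proof.
elim/clind=> a; rewrite fscaleE faddE; apply/clE.
apply: teq_trans (teq_scale0 a); rewrite -(addNr 1).
apply: teq_sym; apply: teq_trans (teq_scaleDl _ _ _) _.
by apply: teq_add; [apply: teq_refl | apply: teq_scale1].
Qed.

HB.instance Definition _ :=
  GRing.isZmodule.Build freeLS faddA faddC fadd0 faddN.

Let fscaleA s t (u : freeLS) : fscale s (fscale t u) = fscale (s * t) u.
Proof. by elim/clind: u => a; rewrite !fscaleE; apply: clE; apply: teq_scaleA. Qed.
Let fscale1 : left_id 1 fscale.
Proof. by elim/clind=> a; rewrite fscaleE; apply: clE; apply: teq_scale1. Qed.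
Let fscaleDr : right_distributive fscale +%R.
Proof.
move=> s; elim/clind=> a; elim/clind=> b.
by rewrite /GRing.add /= faddE !fscaleE faddE; apply: clE; apply: teq_scaleDr.
Qed.
Let fscaleDl (u : freeLS) : {morph fscale^~ u : s t / s + t >-> s + t}.
Proof.
move=> s t; elim/clind: u => a; rewrite /= !fscaleE.
by rewrite [RHS]faddE; apply: clE; apply: teq_scaleDl.
Qed.

HB.instance Definition _ :=
  GRing.Zmodule_isLmodule.Build F freeLS fscaleA fscale1 fscaleDr fscaleDl.

Let clD a b : cl (TAdd a b) = cl a + cl b.
Proof. by rewrite [RHS]faddE. Qed.
Let clZ s a : cl (TScale s a) = s *: cl a.
Proof. by rewrite [RHS]fscaleE. Qed.
Let cl0 : cl TZero = 0. Proof. by []. Qed.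
Let clB a b : cl (TBr a b) = fbr (cl a) (cl b).
Proof. by rewrite fbrE. Qed.

Let fbrDl u v w : fbr (u + v) w = fbr u w + fbr v w.
Proof.
elim/clind: u => a; elim/clind: v => b; elim/clind: w => c.
by rewrite -(clD a b) !fbrE -clD; apply: clE; apply: teq_brDl.
Qed.
Let fbrDr u v w : fbr w (u + v) = fbr w u + fbr w v.
Proof.
elim/clind: u => a; elim/clind: v => b; elim/clind: w => c.
by rewrite -(clD a b) !fbrE -clD; apply: clE; apply: teq_brDr.
Qed.
Let fbrZl s u v : fbr (s *: u) v = s *: fbr u v.
Proof.
elim/clind: u => a; elim/clind: v => b.
by rewrite -(clZ s a) !fbrE -clZ; apply: clE; apply: teq_brZl.
Qed.
Let fbrZr s u v : fbr u (s *: v) = s *: fbr u v.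
Proof.
elim/clind: u => a; elim/clind: v => b.
by rewrite -(clZ s b) !fbrE -clZ; apply: clE; apply: teq_brZr.
Qed.
Let fbr0l u : fbr 0 u = 0. Proof. by have := fbrZl 0 0 u; rewrite !scale0r. Qed.
Let fbr0r u : fbr u 0 = 0. Proof. by have := fbrZr 0 u 0; rewrite !scale0r. Qed.
Let clW := (clD, clZ, cl0, clB).
Let fbrW := (fbrDl, fbrDr, fbrZl, fbrZr, fbr0l, fbr0r).

Fixpoint tproj (p : bool) a : term :=
  match a with
  | TGen j => if par j == p then TGen j else TZero
  | TZero => TZero
  | TAdd a b => TAdd (tproj p a) (tproj p b)
  | TScale s a => TScale s (tproj p a)
  | TBr a b => TAdd (TBr (tproj false a) (tproj p b))
                    (TBr (tproj true a) (tproj (~~ p) b))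
  end.

Let tproj_homog p a : thomog p (tproj p a).
Proof.
elim: a p => [j||a iha b ihb|s a iha|a iha b ihb] p /=.
- by case: eqP => [<-|_]; constructor.
- by constructor.
- by constructor.
- by constructor.
- constructor; first exact: (thomog_br (iha false) (ihb p)).
  by have := thomog_br (iha true) (ihb (~~ p)); rewrite /= negbK.
Qed.

Let tprojE p q a : thomog p a -> cl (tproj q a) = if p == q then cl a else 0.
Proof.
move=> ha; elim: ha q => {p a}.
- by move=> j q /=; case: eqP.
- by move=> p q /=; case: eqP.
- move=> p a b _ iha _ ihb q /=; rewrite !clW iha ihb.
  by case: eqP; rewrite ?addr0.
- by move=> p s a _ iha q /=; rewrite !clW iha; case: eqP; rewrite ?scaler0.
- move=> p p' a b _ iha _ ihb q /=; rewrite !clW !iha !ihb.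
  by case: p p' q {iha ihb} => [] [] [] /=; rewrite !fbrW ?addr0 ?add0r.
Qed.

Let tproj_sum a : cl a = cl (tproj false a) + cl (tproj true a).
Proof.
elim: a => [j||a iha b ihb|s a iha|a iha b ihb] /=.
- by case: (par j) => /=; rewrite !cl0 ?addr0 ?add0r.
- by rewrite cl0 addr0.
- by rewrite !clW addrACA -iha -ihb.
- by rewrite !clW -scalerDr -iha.
- rewrite !clW {1}iha {1}ihb !fbrW [X in _ + X = _]addrC.
  exact: addrACA.
Qed.

Let teq_tproj a b : teq a b -> forall p, cl (tproj p a) = cl (tproj p b).
Proof.
elim=> {a b} /=.
- by [].
- by [].
- by move=> a b c _ ab _ bc p; rewrite ab.
- by move=> a b c d _ ab _ cd p; rewrite !clW ab cd.
- by move=> s a b _ ab p; rewrite !clW ab.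
- by move=> a b c d _ ab _ cd p; rewrite !clW !ab !cd.
- by move=> a b c p; rewrite !clW addrA.
- by move=> a b p; rewrite !clW addrC.
- by move=> a p; rewrite !clW add0r.
- by move=> a p; rewrite !clW scale0r.
- by move=> a p; rewrite !clW scale1r.
- by move=> s t a p; rewrite !clW scalerA.
- by move=> s a b p; rewrite !clW scalerDr.
- by move=> s t a p; rewrite !clW scalerDl.
- by move=> a b c p; rewrite !clW !fbrW addrACA.
- by move=> a b c p; rewrite !clW !fbrW addrACA.
- by move=> s a b p; rewrite !clW !fbrW scalerDr.
- by move=> s a b p; rewrite !clW !fbrW scalerDr.
- move=> p q a b ha hb r.
  have hl := thomog_br ha hb.
  have hr := thomog_scale (- (-1) ^+ (p && q)) (thomog_br hb ha).
  have := tprojE r hl; have := tprojE r hr; rewrite /= => -> ->.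
  by rewrite (addbC q); case: eqP => // _; apply: clE; apply: teq_skew.
- move=> p q r a b c ha hb hc o.
  have hl := thomog_br ha (thomog_br hb hc).
  have h1 := thomog_br (thomog_br ha hb) hc.
  have h2 := thomog_scale ((-1) ^+ (p && q)) (thomog_br hb (thomog_br ha hc)).
  rewrite addbCA addbA in h2; rewrite addbA in hl.
  have := tprojE o hl; have := tprojE o (thomog_add h1 h2).
  rewrite /= => -> ->; case: eqP => // _; apply: clE; apply: (teq_jacobi ha hb hc).
Qed.

Let fhomog (p : bool) (u : freeLS) := exists2 a, thomog p a & u = cl a.

Let fhomog_lin p s u v : fhomog p u -> fhomog p v -> fhomog p (s *: u + v).
Proof.
move=> [a ha ->] [b hb ->]; exists (TAdd (TScale s a) b).
  by apply: thomog_add => //; apply: thomog_scale.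
by rewrite !clW.
Qed.

Let fhomog_dec u : exists u0 u1,
  [/\ fhomog false u0, fhomog true u1 & u = u0 + u1].
Proof.
elim/clind: u => a; exists (cl (tproj false a)), (cl (tproj true a)).
by split; [exists (tproj false a) | exists (tproj true a) | exact: tproj_sum].
Qed.

Let fhomog_dir u : fhomog false u -> fhomog true u -> u = 0.
Proof.
move=> [a ha ->] [b hb /clP ab].
by have := teq_tproj ab false; rewrite (tprojE _ ha) (tprojE _ hb).
Qed.

Let fbr_linl s u v w : fbr (s *: u + v) w = s *: fbr u w + fbr v w.
Proof. by rewrite !fbrW. Qed.
Let fbr_linr s w u v : fbr w (s *: u + v) = s *: fbr w u + fbr w v.
Proof. by rewrite !fbrW. Qed.

Let fhomog_br p q u v : fhomog p u -> fhomog q v -> fhomog (p (+) q) (fbr u v).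
Proof.
move=> [a ha ->] [b hb ->]; exists (TBr a b); last by rewrite clW.
exact: thomog_br.
Qed.

Let fbr_skew p q u v : fhomog p u -> fhomog q v ->
  fbr u v = - ((-1) ^+ (p && q) *: fbr v u).
Proof.
move=> [a ha ->] [b hb ->]; rewrite -!clB -scaleNr -clZ.
by apply: clE; apply: teq_skew.
Qed.

Let fbr_jacobi p q u v w : fhomog p u -> fhomog q v ->
  fbr u (fbr v w) = fbr (fbr u v) w + (-1) ^+ (p && q) *: fbr v (fbr u w).
Proof.
move=> [a ha ->] [b hb ->]; elim/clind: w => c.
have J r c' : thomog r c' -> fbr (cl a) (fbr (cl b) (cl c')) =
    fbr (fbr (cl a) (cl b)) (cl c')
      + (-1) ^+ (p && q) *: fbr (cl b) (fbr (cl a) (cl c')).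
  by move=> hc; rewrite -!clB -clZ -clD; apply: clE; apply: (teq_jacobi ha hb hc).
rewrite (tproj_sum c) !fbrW (J _ _ (tproj_homog _ _)) (J _ _ (tproj_homog _ _)).
by rewrite scalerDr addrACA.
Qed.

HB.instance Definition _ := Lmodule_isLieSuper.Build F freeLS
  fhomog_lin fhomog_dec fhomog_dir fbr_linl fbr_linr fhomog_br fbr_skew
  fbr_jacobi.

Lemma fgen_homog j : homog (par j) (fgen j).
Proof. by exists (TGen j) => //; constructor. Qed.

Section UniversalProperty.
Variables (L : lieSuperType F) (g : X -> L).

Fixpoint teval a : L :=
  match a with
  | TGen j => g j
  | TZero => 0
  | TAdd a b => teval a + teval b
  | TScale s a => s *: teval a
  | TBr a b => lbr (teval a) (teval b)
  end.

Let gbrDl (u v w : L) : lbr (u + v) w = lbr u w + lbr v w.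
Proof. by rewrite -[u]scale1r lbr_linl !scale1r. Qed.
Let gbrDr (u v w : L) : lbr w (u + v) = lbr w u + lbr w v.
Proof. by rewrite -[u]scale1r lbr_linr !scale1r. Qed.
Let gbr0l (w : L) : lbr 0 w = 0.
Proof. by apply: (addrI (lbr 0 w)); rewrite -gbrDl !addr0. Qed.
Let gbr0r (w : L) : lbr w 0 = 0.
Proof. by apply: (addrI (lbr w 0)); rewrite -gbrDr !addr0. Qed.
Let gbrZl s (u w : L) : lbr (s *: u) w = s *: lbr u w.
Proof. by rewrite -[s *: u]addr0 lbr_linl gbr0l addr0. Qed.
Let gbrZr s (u w : L) : lbr w (s *: u) = s *: lbr w u.
Proof. by rewrite -[s *: u]addr0 lbr_linr gbr0r addr0. Qed.
Let ghomog0 p : homog p (0 : L).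
Proof.
have [x0 [x1 [h0 h1 _]]] := homog_dec (0 : L).
by case: p; [rewrite -(addNr x1) | rewrite -(addNr x0)];
  rewrite -scaleN1r; apply: homog_lin.
Qed.

Hypothesis homog_g : forall j, homog (par j) (g j).

Let teval_homog p a : thomog p a -> homog p (teval a).
Proof.
elim=> {p a} //=.
- by move=> p a b _ ha _ hb; rewrite -[teval a]scale1r; apply: homog_lin.
- by move=> p s a _ ha; rewrite -[_ *: _]addr0; apply: homog_lin.
- by move=> p q a b _ ha _ hb; apply: homog_lbr.
Qed.

Let teval_teq a b : teq a b -> teval a = teval b.
Proof.
elim=> {a b} //=.
- by move=> a b c _ -> _.
- by move=> a b c d _ -> _ ->.
- by move=> s a b _ ->.
- by move=> a b c d _ -> _ ->.
- by move=> a b c; rewrite addrA.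
- by move=> a b; rewrite addrC.
- by move=> a; rewrite add0r.
- by move=> a; rewrite scale0r.
- by move=> a; rewrite scale1r.
- by move=> s t a; rewrite scalerA.
- by move=> s a b; rewrite scalerDr.
- by move=> s t a; rewrite scalerDl.
- move=> p q a b /teval_homog ha /teval_homog hb.
  by rewrite (lbr_skew _ _ _ _ ha hb) scaleNr.
- by move=> p q r a b c /teval_homog ha /teval_homog hb _; apply: lbr_jacobi.
Qed.

Let flift (u : freeLS) : L := teval (repr u).

Let fliftE a : flift (cl a) = teval a.
Proof. exact/teval_teq/reprT. Qed.

Lemma freeLS_lift : exists phi : {linear freeLS -> L},
  ls_morphism phi /\ forall j, phi (fgen j) = g j.
Proof.
have lin : linear flift.
  move=> s; elim/clind=> a; elim/clind=> b.
  by rewrite -clZ -clD !fliftE.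
pose mix := GRing.isLinear.Build F freeLS L *:%R flift lin.
pose phi : {linear freeLS -> L} := HB.pack flift mix.
have phiE a : phi (cl a) = teval a by exact: fliftE.
exists phi; split; first split.
- by elim/clind=> a; elim/clind=> b; rewrite [X in phi X]fbrE !phiE.
- by move=> p _ [a ha ->]; rewrite phiE; apply: teval_homog.
- by move=> j; apply: phiE.
Qed.

Lemma freeLS_unique (phi psi : {linear freeLS -> L}) :
  ls_morphism phi -> ls_morphism psi ->
  (forall j, phi (fgen j) = psi (fgen j)) -> phi =1 psi.
Proof.
move=> [mphi _] [mpsi _] eg; elim/clind=> a.
elim: a => [j||a iha b ihb|s a iha|a iha b ihb].
- exact: eg.
- by rewrite cl0 !linear0.
- by rewrite clW !linearD iha ihb.
- by rewrite clW !linearZ iha.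
- by rewrite clW mphi mpsi iha ihb.
Qed.

End UniversalProperty.
End Free.

(* [{malg F[K]}] is the F-space with basis K, where [<< k >>] denotes the basis
   vector k and [u@_k] the k-th coordinate of u. *)
Section Extension.
Variables (F : fieldType) (K1 K2 : choiceType) (V : lmodType F).
Implicit Types (u : {malg F[K1]}) (v : {malg F[K2]}).

Definition lext (K : choiceType) (f : K -> V) (u : {malg F[K]}) : V :=
  \sum_(k <- msupp u) u@_k *: f k.

Definition bext (f : K1 -> K2 -> V) u v : V :=
  lext (fun k => lext (f k) v) u.

Lemma lext_linear (K : choiceType) (f : K -> V) : linear (lext f).
Proof.
have E (D : {fset K}) (w : {malg F[K]}) : (msupp w `<=` D)%fset ->
    lext f w = \sum_(k <- D) w@_k *: f k.
  move=> sD; apply/big_fset_incl => // k _ /mcoeff_outdom ->.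
  by rewrite scale0r.
move=> c u v; pose D := (msupp u `|` msupp v)%fset.
rewrite (E D) ?(E D u) ?(E D v) ?fsubsetUl ?fsubsetUr //; last first.
  apply: fsubset_trans (msuppD_le _ _) _.
  by apply: fsetSU; apply: msuppZ_le.
rewrite scaler_sumr -big_split /=; apply: eq_bigr => k _.
by rewrite mcoeffD mcoeffZ scalerDl scalerA.
Qed.

Lemma lextU (K : choiceType) (f : K -> V) k : lext f << k >> = f k.
Proof.
by rewrite /lext msuppU oner_eq0 big_seq_fset1 mcoeffUU scale1r.
Qed.

Lemma bext_linl f c u u' v :
  bext f (c *: u + u') v = c *: bext f u v + bext f u' v.
Proof. exact: lext_linear. Qed.

Lemma bext_linr f c u v v' :
  bext f u (c *: v + v') = c *: bext f u v + bext f u v'.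
Proof.
rewrite /bext /lext scaler_sumr -big_split; apply: eq_bigr => k _ /=.
by rewrite -!/(lext _ _) lext_linear scalerDr !scalerA mulrC.
Qed.

Lemma bextU f k l : bext f << k >> << l >> = f k l.
Proof. by rewrite /bext !lextU. Qed.

Lemma bext0l f v : bext f 0 v = 0.
Proof. by rewrite /bext /lext msupp0 big_seq_fset0. Qed.
Lemma bext0r f u : bext f u 0 = 0.
Proof. by have := bext_linr f (-1) u 0 0; rewrite scaler0 addr0 scaleN1r addNr. Qed.
Lemma bextZl f c u v : bext f (c *: u) v = c *: bext f u v.
Proof. by rewrite -[c *: u]addr0 bext_linl bext0l addr0. Qed.
Lemma bextZr f c u v : bext f u (c *: v) = c *: bext f u v.
Proof. by rewrite -[c *: v]addr0 bext_linr bext0r addr0. Qed.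
Lemma bextDl f u u' v : bext f (u + u') v = bext f u v + bext f u' v.
Proof. by have := bext_linl f 1 u u' v; rewrite !scale1r. Qed.
Lemma bextDr f u v v' : bext f u (v + v') = bext f u v + bext f u v'.
Proof. by have := bext_linr f 1 u v v'; rewrite !scale1r. Qed.

End Extension.

Lemma malg_ind_supp (F : fieldType) (K : choiceType) (P : {malg F[K]} -> Prop) u :
  P 0 -> (forall c v w, P v -> P w -> P (c *: v + w)) ->
  (forall k, u@_k != 0 -> P << k >>) -> P u.
Proof.
move=> P0 PD Pk; rewrite [u]monalgE big_seq.
elim/big_rec: _ => // k w kin Pw.
have -> : << u@_k *g k >> = u@_k *: << k >>.
  by apply/malgP=> l; rewrite mcoeffZ !mcoeffU mulr_natr.
by apply: PD => //; apply: Pk; rewrite mcoeff_neq0.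
Qed.

Lemma malg_ind (F : fieldType) (K : choiceType) (P : {malg F[K]} -> Prop) :
  P 0 -> (forall c v w, P v -> P w -> P (c *: v + w)) ->
  (forall k, P << k >>) -> forall u, P u.
Proof. by move=> P0 PD Pk u; apply: malg_ind_supp. Qed.

(* Closure of the Jacobi identity under linear combinations *)
Section Jacobi.
Variables (F : fieldType) (V : lmodType F) (br : V -> V -> V).
Hypothesis linl : forall c u v w, br (c *: u + v) w = c *: br u w + br v w.
Hypothesis linr : forall c w u v, br w (c *: u + v) = c *: br w u + br w v.
Implicit Types (s c : F) (u v w : V).

Let jac s u v w := br u (br v w) = br (br u v) w + s *: br v (br u w).

Let linsum c s (a a' b b' d d' : V) :
  a = b + s *: d -> a' = b' + s *: d' ->
  c *: a + a' = c *: b + b' + s *: (c *: d + d').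
Proof. by move=> -> ->; rewrite !scalerDr !scalerA (mulrC c s) addrACA. Qed.

Let br0r u : br u 0 = 0.
Proof. by have := linr (-1) u 0 0; rewrite scaler0 addr0 scaleN1r addNr. Qed.
Let br0l u : br 0 u = 0.
Proof. by have := linl (-1) 0 0 u; rewrite scaler0 addr0 scaleN1r addNr. Qed.
Let brZr c u v : br u (c *: v) = c *: br u v.
Proof. by rewrite -[c *: v]addr0 linr br0r addr0. Qed.
Let brZl c u v : br (c *: u) v = c *: br u v.
Proof. by rewrite -[c *: u]addr0 linl br0l addr0. Qed.

Lemma jac1 s c u1 u2 v w : jac s u1 v w -> jac s u2 v w -> jac s (c *: u1 + u2) v w.
Proof. by move=> h1 h2; rewrite /jac !(linl, linr); apply: linsum. Qed.
Lemma jac2 s c v1 v2 u w : jac s u v1 w -> jac s u v2 w -> jac s u (c *: v1 + v2) w.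
Proof. by move=> h1 h2; rewrite /jac !(linl, linr); apply: linsum. Qed.
Lemma jac3 s c w1 w2 u v : jac s u v w1 -> jac s u v w2 -> jac s u v (c *: w1 + w2).
Proof. by move=> h1 h2; rewrite /jac !linr; apply: linsum. Qed.
Lemma jac0 s u v : jac s u v 0.
Proof. by rewrite /jac !br0r scaler0 addr0. Qed.

Lemma jac_basis s u v w uv vw uw x (a b c d e f : F) :
  br u v = a *: uv -> br v w = b *: vw -> br u w = c *: uw ->
  br u vw = d *: x -> br uv w = e *: x -> br v uw = f *: x ->
  b * d = a * e + s * (c * f) -> jac s u v w.
Proof.
rewrite /jac => -> -> -> E1 E2 E3 h.
by rewrite !brZr !brZl E1 E2 E3 !scalerA -scalerDl h mulrA.
Qed.

End Jacobi.

(* The basis vector i of F[t, t^-1] is t ^ i. *)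
Notation laurent F := {malg F[int]}.

Section Laurent.
Variable F : fieldType.

Definition tpow (i : int) : laurent F := << i >>.
Definition lau_mul : laurent F -> laurent F -> laurent F :=
  bext (fun i j => tpow (i + j)).
Definition lau_br : laurent F -> laurent F -> laurent F :=
  bext (fun i j => (i - j)%:~R *: tpow (i + j)).
Definition lau_D (a : laurent F) : laurent F := lau_br a (tpow 0).

Lemma lau_mulU i j : lau_mul (tpow i) (tpow j) = tpow (i + j).
Proof. exact: bextU. Qed.
Lemma lau_brU i j : lau_br (tpow i) (tpow j) = (i - j)%:~R *: tpow (i + j).
Proof. exact: bextU. Qed.
Lemma lau_DU i : lau_D (tpow i) = i%:~R *: tpow i.
Proof. by rewrite /lau_D lau_brU subr0 ?addr0. Qed.

Lemma lau_mul_linl c a a' b :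
  lau_mul (c *: a + a') b = c *: lau_mul a b + lau_mul a' b.
Proof. exact: bext_linl. Qed.
Lemma lau_mul_linr c a b b' :
  lau_mul a (c *: b + b') = c *: lau_mul a b + lau_mul a b'.
Proof. exact: bext_linr. Qed.
Lemma lau_br_linl c a a' b :
  lau_br (c *: a + a') b = c *: lau_br a b + lau_br a' b.
Proof. exact: bext_linl. Qed.
Lemma lau_br_linr c a b b' :
  lau_br a (c *: b + b') = c *: lau_br a b + lau_br a b'.
Proof. exact: bext_linr. Qed.
Lemma lau_D_lin c a a' : lau_D (c *: a + a') = c *: lau_D a + lau_D a'.
Proof. exact: bext_linl. Qed.

End Laurent.

(* The basis vector (e1, e2) of G(2) is the monomial xi_1^e1 xi_2^e2. *)
Notation gmon := (bool * bool)%type.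
Notation grassmann2 F := {malg F[gmon]}.

Definition gdeg (b : gmon) : nat := (b.1 + b.2)%N.
Definition gpar (b : gmon) : bool := b.1 (+) b.2.

Section Grassmann.
Variable F : fieldType.
Implicit Types b c : gmon.

Definition gmul : grassmann2 F -> grassmann2 F -> grassmann2 F :=
  bext (fun b c =>
    if b.1 && c.1 || b.2 && c.2 then 0
    else (-1) ^+ (b.2 && c.1) *: << (b.1 || c.1, b.2 || c.2) >>).

(* Left partial derivatives with respect to xi_1 and xi_2 *)
Definition gder1 : grassmann2 F -> grassmann2 F :=
  lext (fun b => if b.1 then << (false, b.2) >> else 0).
Definition gder2 : grassmann2 F -> grassmann2 F :=
  lext (fun b => if b.2 then (-1) ^+ b.1 *: << (b.1, false) >> else 0).

Definition gbr : grassmann2 F -> grassmann2 F -> grassmann2 F :=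
  bext (fun b c =>
    (-1) ^+ gpar b *: (gmul (gder1 << b >>) (gder1 << c >>)
                       + gmul (gder2 << b >>) (gder2 << c >>))).

Definition gxor b c : gmon := (b.1 (+) c.1, b.2 (+) c.2).

Definition gmul_sg b c : F :=
  if b.1 && c.1 || b.2 && c.2 then 0 else (-1) ^+ (b.2 && c.1).

Lemma gmulU b c : gmul << b >> << c >> = gmul_sg b c *: << gxor b c >>.
Proof.
rewrite /gmul bextU /gmul_sg /gxor; case: ifP; first by rewrite scale0r.
move/norP=> [/negP h1 /negP h2].
have -> : b.1 || c.1 = b.1 (+) c.1 by move: h1; case: (b.1) (c.1) => [] [].
by have -> : b.2 || c.2 = b.2 (+) c.2 by move: h2; case: (b.2) (c.2) => [] [].
Qed.

Definition gbr_sg b c : F :=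
  (-1) ^+ gpar b *
  (if b.1 && c.1 then (~~ (b.2 && c.2))%:R else
   if b.2 && c.2 then (-1) ^+ (b.1 + c.1)%N else 0).

Lemma gbrU b c : gbr << b >> << c >> = gbr_sg b c *: << gxor b c >>.
Proof.
rewrite /gbr bextU /gder1 /gder2 !lextU /gbr_sg -scalerA; congr (_ *: _).
case: b c => [b1 b2] [c1 c2] /=.
have Z1 (u : grassmann2 F) : gmul 0 u = 0 by exact: bext0l.
have Z2 (u : grassmann2 F) : gmul u 0 = 0 by exact: bext0r.
have E (s t : F) b c : gmul (s *: << b >>) (t *: << c >>)
    = (s * t * gmul_sg b c) *: << gxor b c >>.
  by rewrite /gmul bextZl bextZr -/gmul gmulU !scalerA.
have E1 (b c : gmon) : gmul << b >> << c >> = gmul_sg b c *: << gxor b c >>.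
  exact: gmulU.
case: b1; case: b2; case: c1; case: c2; rewrite /= ?Z1 ?Z2 ?E ?E1 ?addr0 ?add0r.
all: rewrite ?scale0r ?addr0 //= /gmul_sg /gxor /= ?scale0r ?mulr0 ?scale0r ?addr0 //.
all: by rewrite -?exprD ?mulr1.
Qed.

End Grassmann.

(* The underlying space of K(A:2), with basis the tensors t ^ i (x) b *)
Notation kspace F := {malg F[(int * gmon)%type]}.

Section KA2Bracket.
Variable F : fieldType.

Definition tens : laurent F -> grassmann2 F -> kspace F :=
  bext (fun i b => << (i, b) >>).

(* The bracket [a1 b1, a2 b2] for monomials b1 and b2 *)
Definition kbr_tens (a1 : laurent F) (b1 : gmon) (a2 : laurent F) (b2 : gmon) :
    kspace F :=
  tens (lau_br a1 a2) (gmul << b1 >> << b2 >>)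
  + tens (lau_mul a1 a2) (gbr << b1 >> << b2 >>)
  + 2^-1 *: tens ((gdeg b1)%:R *: lau_mul a1 (lau_D a2)
                  - (gdeg b2)%:R *: lau_mul (lau_D a1) a2)
                 (gmul << b1 >> << b2 >>).

Definition kbr : kspace F -> kspace F -> kspace F :=
  bext (fun k l : int * gmon => kbr_tens (tpow F k.1) k.2 (tpow F l.1) l.2).

Hypothesis two_neq0 : 2%:R != 0 :> F.

Definition kcoef (k l : int * gmon) : F :=
  (k.1 - l.1)%:~R * gmul_sg F k.2 l.2 + gbr_sg F k.2 l.2
  + 2^-1 * ((gdeg k.2)%:R * l.1%:~R - (gdeg l.2)%:R * k.1%:~R)
    * gmul_sg F k.2 l.2.

Definition kadd (k l : int * gmon) : int * gmon :=
  (k.1 + l.1, gxor k.2 l.2).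

Lemma tensU s i b : tens (tpow F i) (s *: << b >>) = s *: << (i, b) >>.
Proof. by rewrite /tens bextZr bextU. Qed.

Lemma tensUU i b : tens << i >> << b >> = << (i, b) >>.
Proof. exact: bextU. Qed.

Lemma tens_linl c a a' b : tens (c *: a + a') b = c *: tens a b + tens a' b.
Proof. exact: bext_linl. Qed.

Lemma tensZl s (a : laurent F) (b : grassmann2 F) :
  tens (s *: a) b = s *: tens a b.
Proof. exact: bextZl. Qed.

Lemma kbrU k l : kbr << k >> << l >> = kcoef k l *: << kadd k l >>.
Proof.
rewrite /kbr bextU /kbr_tens lau_brU lau_mulU !lau_DU gmulU gbrU.
have -> : lau_mul (tpow F k.1) (l.1%:~R *: tpow F l.1)
    = l.1%:~R *: tpow F (k.1 + l.1) by rewrite /lau_mul bextZr bextU.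
have -> : lau_mul (k.1%:~R *: tpow F k.1) (tpow F l.1)
    = k.1%:~R *: tpow F (k.1 + l.1) by rewrite /lau_mul bextZl bextU.
by rewrite !scalerA -scalerBl !tensZl !tensU !scalerA -!scalerDl.
Qed.

Lemma kbr_linl c u v w : kbr (c *: u + v) w = c *: kbr u w + kbr v w.
Proof. exact: bext_linl. Qed.
Lemma kbr_linr c w u v : kbr w (c *: u + v) = c *: kbr w u + kbr w v.
Proof. exact: bext_linr. Qed.
Lemma kbr_def k l :
  kbr << k >> << l >> = kbr_tens (tpow F k.1) k.2 (tpow F l.1) l.2.
Proof. exact: bextU. Qed.
Lemma kbr0l u : kbr 0 u = 0.
Proof. exact: bext0l. Qed.
Lemma kbr0r u : kbr u 0 = 0.
Proof. exact: bext0r. Qed.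
Lemma kbrZl c u v : kbr (c *: u) v = c *: kbr u v.
Proof. exact: bextZl. Qed.
Lemma kbrZr c u v : kbr u (c *: v) = c *: kbr u v.
Proof. exact: bextZr. Qed.

Lemma kjac k l m (sg : F) :
  sg = (-1) ^+ (gpar k.2 && gpar l.2) ->
  kcoef l m * kcoef k (kadd l m) = kcoef k l * kcoef (kadd k l) m
   + sg * (kcoef k m * kcoef l (kadd k m)).
Proof.
move=> ->; case: k => i [b1 b2]; case: l => j [c1 c2]; case: m => n [d1 d2].
rewrite /kcoef /kadd /gmul_sg /gbr_sg /gpar /gdeg /gxor /=.
case: b1; case: b2; case: c1; case: c2; case: d1; case: d2; rewrite /= ?rmorphD /=.
all: field; exact: two_neq0.
Qed.

Lemma kcoefC k l : kcoef k l = - ((-1) ^+ (gpar k.2 && gpar l.2) * kcoef l k).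
Proof.
case: k => i [b1 b2]; case: l => j [c1 c2].
rewrite /kcoef /gmul_sg /gbr_sg /gpar /gdeg /=.
case: b1; case: b2; case: c1; case: c2; rewrite /= ?rmorphB ?rmorphD /=.
all: by field; exact: two_neq0.
Qed.

Lemma kaddP k l : gpar (kadd k l).2 = gpar k.2 (+) gpar l.2.
Proof.
case: k l => i [b1 b2] [j [c1 c2]]; rewrite /gpar /kadd /=.
by case: b1 b2 c1 c2 => [] [] [] [].
Qed.

Lemma kaddC k l : kadd k l = kadd l k.
Proof.
by rewrite /kadd /gxor addrC (addbC k.2.1) (addbC k.2.2).
Qed.

Lemma kaddA k l m : kadd k (kadd l m) = kadd (kadd k l) m.
Proof. by rewrite /kadd /gxor /= addrA !addbA. Qed.

Local Opaque kbr kcoef kadd.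

(* A is purely even, so the parity is that of the Grassmann factor. *)
Definition khomog (p : bool) (u : kspace F) :=
  forall k, u@_k != 0 -> gpar k.2 = p.

Lemma khomog_lin p c u v : khomog p u -> khomog p v -> khomog p (c *: u + v).
Proof.
move=> hu hv k; rewrite mcoeffD mcoeffZ.
case: (eqVneq u@_k 0) => [->|/hu //]; rewrite mulr0 add0r; exact: hv.
Qed.

Lemma khomogU p k : gpar k.2 = p -> khomog p << k >>.
Proof.
by move=> <- l; rewrite mcoeffU; case: (k =P l) => [->|_] //=; rewrite eqxx.
Qed.

Lemma khomog_dec u : exists u0 u1,
  [/\ khomog false u0, khomog true u1 & u = u0 + u1].
Proof.
elim/malg_ind: u => [|c v w [v0 [v1 [hv0 hv1 ->]]] [w0 [w1 [hw0 hw1 ->]]]|k].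
- by exists 0, 0; rewrite addr0; split=> // k; rewrite mcoeff0 eqxx.
- exists (c *: v0 + w0), (c *: v1 + w1).
  by split; [exact: khomog_lin | exact: khomog_lin | rewrite scalerDr addrACA].
have h0 p : khomog p 0 by move=> l; rewrite mcoeff0 eqxx.
case E: (gpar k.2); [exists 0, << k >> | exists << k >>, 0].
  by rewrite add0r; split=> //; apply: khomogU.
by rewrite addr0; split=> //; apply: khomogU.
Qed.

Lemma khomog_dir u : khomog false u -> khomog true u -> u = 0.
Proof.
move=> h0 h1; apply/malgP => k; rewrite mcoeff0; apply/eqP/negPn/negP => nz.
by have := h1 _ nz; rewrite (h0 _ nz).
Qed.

Lemma khomog_ind p (P : kspace F -> Prop) :
  (forall c v w, P v -> P w -> P (c *: v + w)) ->
  (forall k, gpar k.2 = p -> P << k >>) -> forall u, khomog p u -> P u.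
Proof.
move=> PD Pk u hu; pose k0 : int * gmon := (0, (p, false)).
have P0 : P 0.
  rewrite -(addNr << k0 >>) -scaleN1r.
  by apply: PD; apply: Pk; rewrite /gpar /= addbF.
by apply: malg_ind_supp => // k /hu; apply: Pk.
Qed.

Lemma khomog_br p q u v : khomog p u -> khomog q v -> khomog (p (+) q) (kbr u v).
Proof.
move=> hu hv; elim/khomog_ind: u / hu => [c v1 v2 h1 h2|k hk].
  by rewrite kbr_linl; apply: khomog_lin.
elim/khomog_ind: v / hv => [c v1 v2 h1 h2|l hl].
  by rewrite kbr_linr; apply: khomog_lin.
have h0 : khomog (p (+) q) 0 by move=> m; rewrite mcoeff0 eqxx.
rewrite kbrU -[_ *: _]addr0; apply: khomog_lin h0.
by apply: khomogU; rewrite kaddP hk hl.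
Qed.

Lemma kbr_skew p q u v : khomog p u -> khomog q v ->
  kbr u v = - ((-1) ^+ (p && q) *: kbr v u).
Proof.
move=> hu hv; elim/khomog_ind: u / hu => [c v1 v2 h1 h2|k hk].
  rewrite kbr_linl kbr_linr h1 h2 !scalerDr opprD !scalerN !scalerA.
  by rewrite [c * _]mulrC.
elim/khomog_ind: v / hv => [c v1 v2 h1 h2|l hl].
  rewrite kbr_linl kbr_linr h1 h2 !scalerDr opprD !scalerN !scalerA.
  by rewrite [c * _]mulrC.
by rewrite !kbrU kcoefC hk hl scaleNr scalerA kaddC.
Qed.

Lemma kbr_jacobi p q u v w : khomog p u -> khomog q v ->
  kbr u (kbr v w) = kbr (kbr u v) w + (-1) ^+ (p && q) *: kbr v (kbr u w).
Proof.
set s := (-1) ^+ _ => hu hv.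
elim/khomog_ind: u / hu => [c u1 u2|k hk].
  exact: (jac1 kbr_linl kbr_linr).
elim/khomog_ind: v / hv => [c v1 v2|l hl].
  exact: (jac2 kbr_linl kbr_linr).
elim/malg_ind: w => [|c w1 w2|m].
- exact: (jac0 kbr_linr).
- exact: (jac3 kbr_linr).
apply: (jac_basis kbr_linl kbr_linr (kbrU k l) (kbrU l m) (kbrU k m)
  (kbrU k (kadd l m))); first last.
- by apply: kjac; rewrite hk hl.
- by rewrite kaddA (kaddC k l) -kaddA; apply: kbrU.
by rewrite kaddA; apply: kbrU.
Qed.

Local Opaque lau_mul lau_br lau_D gmul gbr tens.

Let lin (V W : lmodType F) (f : V -> W) :=
  forall c x y, f (c *: x + y) = c *: f x + f y.

(* The defining formula holds for arbitrary Laurent polynomials. *)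
Lemma kbr_tensE a1 b1 a2 b2 :
  kbr (tens a1 << b1 >>) (tens a2 << b2 >>) = kbr_tens a1 b1 a2 b2.
Proof.
have comb (V W : lmodType F) (f0 f1 f2 f3 : V -> V) (g0 g1 : V -> W) (d e h : F) :
    lin f0 -> lin f1 -> lin f2 -> lin f3 -> lin g0 -> lin g1 ->
    lin (fun a => g0 (f0 a) + g1 (f1 a) + h *: g0 (d *: f2 a - e *: f3 a)).
  move=> l0 l1 l2 l3 m0 m1 c x y; rewrite l0 l1 l2 l3.
  have -> : d *: (c *: f2 x + f2 y) - e *: (c *: f3 x + f3 y)
      = c *: (d *: f2 x - e *: f3 x) + (d *: f2 y - e *: f3 y).
    by rewrite !scalerDr !scalerN !scalerA (mulrC d) (mulrC e) opprD addrACA.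
  rewrite (m0 c (f0 x)) (m0 c (_ - _)) m1 !scalerDr !scalerA (mulrC h).
  rewrite (addrACA (c *: g0 (f0 x))).
  exact: addrACA.
have lD a : lin (fun x => lau_mul (lau_D x) a).
  by move=> c x y; rewrite lau_D_lin lau_mul_linl.
have kl c a a' a'' : kbr_tens (c *: a + a') b1 a'' b2
    = c *: kbr_tens a b1 a'' b2 + kbr_tens a' b1 a'' b2.
  refine (comb (laurent F) (kspace F) (fun x => lau_br x a'')
    (fun x => lau_mul x a'') (fun x => lau_mul x (lau_D a''))
    (fun x : laurent F => lau_mul (lau_D x) a'') (fun x => tens x _) (fun x => tens x _)
    _ _ _ _ _ _ (lD _) _ _ c a a').
  - by move=> *; apply: lau_br_linl.
  - by move=> *; apply: lau_mul_linl.
  - by move=> *; apply: lau_mul_linl.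
  - by move=> *; apply: tens_linl.
  - by move=> *; apply: tens_linl.
have kr c a a' a'' : kbr_tens a'' b1 (c *: a + a') b2
    = c *: kbr_tens a'' b1 a b2 + kbr_tens a'' b1 a' b2.
  refine (comb (laurent F) (kspace F) (lau_br a'') (lau_mul a'') (fun x : laurent F => lau_mul a'' (lau_D x))
    (fun x => lau_mul (lau_D a'') x) (fun x => tens x _) (fun x => tens x _)
    _ _ _ _ _ _ _ _ _ c a a').
  - by move=> *; apply: lau_br_linr.
  - by move=> *; apply: lau_mul_linr.
  - by move=> x y y'; rewrite lau_D_lin lau_mul_linr.
  - by move=> *; apply: lau_mul_linr.
  - by move=> *; apply: tens_linl.
  - by move=> *; apply: tens_linl.
have cong c (x x' y y' : kspace F) :
    x = x' -> y = y' -> c *: x + y = c *: x' + y' by move=> -> ->.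
have z (V W : lmodType F) (f : V -> W) :
    (forall c a a', f (c *: a + a') = c *: f a + f a') -> f 0 = 0.
  by move=> h; have := h (-1) 0 0; rewrite scaler0 addr0 scaleN1r addNr.
elim/malg_ind: a1 => [|c a a' ha ha'|i].
- rewrite (z _ _ (fun a => kbr_tens a b1 a2 b2) (fun c a a' => kl c a a' a2)).
  by rewrite (z _ _ (fun a => tens a << b1 >>) (fun c a a' => tens_linl c a a' _)) kbr0l.
- rewrite (tens_linl c a a') (kbr_linl c (tens a _)) (kl c a a').
  exact: cong ha ha'.
elim/malg_ind: a2 => [|c a a' ha ha'|j].
- rewrite (z _ _ (fun a => kbr_tens << i >> b1 a b2) (fun c a a' => kr c a a' _)).
  by rewrite (z _ _ (fun a => tens a << b2 >>) (fun c a a' => tens_linl c a a' _)) kbr0r.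
- rewrite (tens_linl c a a') (kbr_linr c (tens << i >> _) (tens a _)).
  rewrite (kr c a a'); exact: cong ha ha'.
by rewrite !tensUU; exact: kbr_def.
Qed.

End KA2Bracket.

(* t ^ 2, t ^ -2, t ^ 4, t ^ -4, xi_1, t xi_2, t xi_1 xi_2, t ^ -1 xi_1 xi_2 *)
Definition gen_mon : 8.-tuple (int * gmon) :=
  [tuple (2, (false, false)); (- 2%:Z, (false, false));
         (4, (false, false)); (- 4%:Z, (false, false));
         (0, (true, false)); (1, (false, true));
         (1, (true, true)); (- 1%:Z, (true, true))].

Definition gen_par (j : 'I_8) : bool := gpar (tnth gen_mon j).2.

(* The Lie superalgebra K(A:2).  The hypothesis on F is carried by the type
   because the Jacobi identity requires the characteristic not to be 2. *)
Definition KA2 (F : fieldType) (charF : [pchar F] =i pred0) : Type := kspace F.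

Section KA2.
Variables (F : fieldType) (charF : [pchar F] =i pred0).
Local Notation K := (KA2 charF).

HB.instance Definition _ := GRing.Lmodule.copy K (kspace F).

Let two_neq0 : 2%:R != 0 :> F.
Proof. by have := charF 2; rewrite !inE /= => ->. Qed.

HB.instance Definition _ := Lmodule_isLieSuper.Build F K
  (@khomog_lin F) (@khomog_dec F) (@khomog_dir F) (@kbr_linl F) (@kbr_linr F)
  (@khomog_br F) (kbr_skew two_neq0) (kbr_jacobi two_neq0).

(* The basis vectors t ^ i (x) xi_1^e1 xi_2^e2 spanning K^(2)(A:2): i is even if
   e2 = 0 and odd if e2 = 1. *)
Definition ramond_mon (k : int * gmon) : bool := odd `|k.1|%N == k.2.2.

Definition ramond_pred : {pred K} :=
  [pred u : K | all ramond_mon (msupp (u : kspace F))].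

Lemma ramond_mon_kadd k l :
  ramond_mon k -> ramond_mon l -> ramond_mon (kadd k l).
Proof.
have oddD (i j : int) : odd (absz (i + j)) = odd (absz i) (+) odd (absz j).
  by lia.
rewrite /ramond_mon /kadd /= oddD => /eqP -> /eqP ->; exact: eqxx.
Qed.

Lemma ramondP (u : K) :
  reflect (forall k, (u : kspace F)@_k != 0 -> ramond_mon k) (u \in ramond_pred).
Proof.
apply: (iffP allP) => h k; first by rewrite mcoeff_neq0; apply: h.
by rewrite -mcoeff_neq0; apply: h.
Qed.

Lemma ramond_submod : submod_closed ramond_pred.
Proof.
split=> [|c u v /ramondP hu /ramondP hv]; apply/ramondP => k.
  by rewrite mcoeff0 eqxx.
rewrite mcoeffD mcoeffZ.
by case: (eqVneq u@_k 0) => [->|/hu //]; rewrite mulr0 add0r; apply: hv.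
Qed.

HB.instance Definition _ := GRing.isSubmodClosed.Build F K ramond_pred ramond_submod.

Lemma ramond_kbr (u v : K) :
  u \in ramond_pred -> v \in ramond_pred -> (lbr u v : K) \in ramond_pred.
Proof.
move=> /ramondP hu /ramondP hv.
have C c (x y : kspace F) : (x : K) \in ramond_pred -> (y : K) \in ramond_pred ->
    (c *: x + y : K) \in ramond_pred by case: ramond_submod => _; apply.
have Z : (0 : K) \in ramond_pred by case: ramond_submod.
pose P (x : kspace F) := (kbr x v : K) \in ramond_pred.
apply: (@malg_ind_supp _ _ P) => [|c x y hx hy|k hk].
- by rewrite /P kbr0l.
- by rewrite /P kbr_linl; exact: (C _ _ _ hx hy).
pose Q (y : kspace F) := (kbr << k >> y : K) \in ramond_pred.
apply: (@malg_ind_supp _ _ Q) => [|c x y hx hy|l hl].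
- by rewrite /Q kbr0r.
- by rewrite /Q kbr_linr; exact: (C _ _ _ hx hy).
have hm : (<< kadd k l >> : K) \in ramond_pred.
  apply/ramondP => m; rewrite mcoeffU.
  case: (kadd k l =P m) => [<- _|_]; last by rewrite eqxx.
  exact: ramond_mon_kadd (hu _ hk) (hv _ hl).
rewrite /Q kbrU; have := C (kcoef F k l) _ _ hm Z.
by rewrite [X in X \in _]addr0.
Qed.

Record KRamond := MkKRamond { kr_val :> K; _ : kr_val \in ramond_pred }.

HB.instance Definition _ := [isSub for kr_val].
HB.instance Definition _ := [Choice of KRamond by <:].
HB.instance Definition _ := [SubChoice_isSubLmodule of KRamond by <:].

Let rhomog (p : bool) (u : KRamond) := homog p (kr_val u).
Let rbr (u v : KRamond) : KRamond := MkKRamond (ramond_kbr (valP u) (valP v)).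

Let rhomog_lin p c u v : rhomog p u -> rhomog p v -> rhomog p (c *: u + v).
Proof. exact: homog_lin. Qed.

Let rhomog_dec u : exists u0 u1,
  [/\ rhomog false u0, rhomog true u1 & u = u0 + u1].
Proof.
have [u0 [u1 [h0 h1 e]]] := khomog_dec (kr_val u).
have /ramondP hu := valP u.
have r0 : (u0 : K) \in ramond_pred.
  apply/ramondP => k nz; apply: hu; rewrite /= e mcoeffD.
  case: (eqVneq u1@_k 0) => [->|/h1]; first by rewrite addr0.
  by rewrite (h0 _ nz).
have r1 : (u1 : K) \in ramond_pred.
  apply/ramondP => k nz; apply: hu; rewrite /= e mcoeffD.
  case: (eqVneq u0@_k 0) => [->|/h0]; first by rewrite add0r.
  by rewrite (h1 _ nz).
by exists (MkKRamond r0), (MkKRamond r1); split=> //; apply: val_inj.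
Qed.

Let rhomog_dir u : rhomog false u -> rhomog true u -> u = 0.
Proof. by move=> h0 h1; apply: val_inj; apply: homog_dir. Qed.

Let rbr_linl c u v w : rbr (c *: u + v) w = c *: rbr u w + rbr v w.
Proof. by apply: val_inj; apply: lbr_linl. Qed.
Let rbr_linr c w u v : rbr w (c *: u + v) = c *: rbr w u + rbr w v.
Proof. by apply: val_inj; apply: lbr_linr. Qed.

Let rhomog_br p q u v : rhomog p u -> rhomog q v -> rhomog (p (+) q) (rbr u v).
Proof. exact: homog_lbr. Qed.

Let rbr_skew p q u v : rhomog p u -> rhomog q v ->
  rbr u v = - ((-1) ^+ (p && q) *: rbr v u).
Proof. by move=> hu hv; apply: val_inj; apply: (lbr_skew _ _ _ _ hu hv). Qed.

Let rbr_jacobi p q u v w : rhomog p u -> rhomog q v ->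
  rbr u (rbr v w) = rbr (rbr u v) w + (-1) ^+ (p && q) *: rbr v (rbr u w).
Proof. by move=> hu hv; apply: val_inj; apply: (lbr_jacobi _ _ _ _ _ hu hv). Qed.

HB.instance Definition _ := Lmodule_isLieSuper.Build F KRamond
  rhomog_lin rhomog_dec rhomog_dir rbr_linl rbr_linr rhomog_br rbr_skew
  rbr_jacobi.

Lemma ramond_genP (j : 'I_8) : (<< tnth gen_mon j >> : K) \in ramond_pred.
Proof.
apply/ramondP => k; rewrite mcoeffU; case: (_ =P k) => [<- _|_]; last first.
  by rewrite eqxx.
have /all_tnthP h : all ramond_mon gen_mon by [].
exact: h.
Qed.

Definition ramond_gen (j : 'I_8) : KRamond := MkKRamond (ramond_genP j).

Lemma ramond_gen_homog j : homog (gen_par j) (ramond_gen j).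
Proof. exact: khomogU. Qed.

End KA2.

(* Main.v *)
Require Import Defs.
From HB Require Import structures.
From mathcomp Require Import all_boot all_order all_algebra.
From mathcomp Require Import generic_quotient ring_quotient.
From mathcomp Require Import finmap boolp monalg ring zify.

Set Implicit Arguments.
Unset Strict Implicit.
Unset Printing Implicit Defensive.

Import GRing.Theory.
Local Open Scope ring_scope.
Local Open Scope quotient_scope.

(* Only three generators matter: b = xi_1, d = t xi_1 xi_2, e = t^-1 xi_1 xi_2,
   since relations of small degree express the others through them.  The
   elements p = t xi_2 = - [b, d] and q = t^-1 xi_2 = - [b, e] generate a copy
   of osp(1|2), under which b, d, e span in L an irreducible module M with
   basis B k = t^(2k) xi_1 and D k = t^(2k+1) xi_1 xi_2.  In the Lie
   superalgebra presented by the relations of degree at most 5 the same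
   recursion defines B k and D k; put C k = - [b, D k] (that is, t^(2k+1) xi_2)
   and A k = - [b, B k] (that is, t^(2k)).  The span of these four families is
   closed under ad b because (ad b)^2 is half of ad [b, b], the grading
   operator, and it is closed under ad d and ad e as soon as
     X i j = [D i, D j] = 0,  Y i j = [B i, D j] + C (i + j) = 0.
   Together with Z i j = [B i, B j] + A (i + j), these are shown to vanish by
   induction on the weight.  In a given weight, osp(1|2)-equivariance leaves at
   most one unknown vector, which is killed by parity, by a relation of degree
   at most 5, or by applying (ad B 1)^2 to a relation four weights below: the
   unknown is then multiplied by an integer that is not 0.  The negative weights
   follow from the automorphism t -> t^-1, which needs a square root of -1. *)

(** * Linear identities in a module, decided coefficient by coefficient *)

Inductive lcomb (F : Type) :=
| LAtom of nat
| LZero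
| LAdd of lcomb F & lcomb F
| LOpp of lcomb F
| LScale of F & lcomb F.
Arguments LAtom {F}.
Arguments LZero {F}.

Section LinearCombinations.
Variables (F : fieldType) (V : lmodType F).

Fixpoint lcomb_eval (xs : seq V) (e : lcomb F) : V :=
  match e with
  | LAtom i => xs`_i
  | LZero => 0
  | LAdd a b => lcomb_eval xs a + lcomb_eval xs b
  | LOpp a => - lcomb_eval xs a
  | LScale c a => c *: lcomb_eval xs a
  end.

Fixpoint lcomb_coef (i : nat) (e : lcomb F) : F :=
  match e with
  | LAtom j => if Nat.eqb i j then 1 else 0
  | LZero => 0
  | LAdd a b => lcomb_coef i a + lcomb_coef i b
  | LOpp a => - lcomb_coef i a
  | LScale c a => c * lcomb_coef i a
  end.

Fixpoint lcomb_wf (n : nat) (e : lcomb F) : bool :=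
  match e with
  | LAtom j => Nat.ltb j n
  | LZero => true
  | LAdd a b => lcomb_wf n a && lcomb_wf n b
  | LOpp a => lcomb_wf n a
  | LScale _ a => lcomb_wf n a
  end.

(** An explicit conjunction rather than a quantified statement: it unfolds to one scalar goal per
    atom, ready for [ring] or [field]. *)
Fixpoint lcomb_eqs (n : nat) (e e' : lcomb F) : Prop :=
  if n is m.+1 then lcomb_coef m e = lcomb_coef m e' /\ lcomb_eqs m e e'
  else True.

Lemma lcomb_evalE xs e : lcomb_wf (size xs) e ->
  lcomb_eval xs e = \sum_(i < size xs) lcomb_coef i e *: xs`_i.
Proof.
elim: e => [j||a iha b ihb|a iha|c a iha] /=.
- move=> /PeanoNat.Nat.ltb_spec0/ltP hj.
  rewrite (bigD1 (Ordinal hj)) //= PeanoNat.Nat.eqb_refl scale1r big1 ?addr0 //.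
  move=> i /negP ne; case: PeanoNat.Nat.eqb_spec => [e|]; last by rewrite scale0r.
  by case: ne; apply/eqP/val_inj.
- by rewrite big1 // => i _; rewrite scale0r.
- case/andP=> /iha -> /ihb ->; rewrite -big_split /=.
  by apply: eq_bigr => i _; rewrite scalerDl.
- by move/iha->; rewrite -sumrN; apply: eq_bigr => i _; rewrite scaleNr.
- by move/iha->; rewrite scaler_sumr; apply: eq_bigr => i _; rewrite scalerA.
Qed.

Lemma lcomb_eq xs e e' : lcomb_wf (size xs) e -> lcomb_wf (size xs) e' ->
  lcomb_eqs (size xs) e e' -> lcomb_eval xs e = lcomb_eval xs e'.
Proof.
move=> /lcomb_evalE -> /lcomb_evalE -> h; apply: eq_bigr => -[i /= hi] _.
congr (_ *: _); elim: (size xs) h hi => // n ih /= [h1 /ih h2].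
by rewrite ltnS leq_eqVlt => /orP[/eqP->|/h2].
Qed.

(** Chained uses certify a goal as an explicit linear combination of known equations, and leave an
    identity for [lmod_coefs]. *)
Lemma lincomb (c : F) (x y l r : V) :
  x = y -> l - c *: x = r - c *: y -> l = r.
Proof. by move=> -> /addIr. Qed.

End LinearCombinations.
Arguments lincomb {F V} c {x y l r}.

(* Atoms are compared up to unification: the same scalar or vector may be built
   along different inheritance paths of the algebraic hierarchy. *)
Ltac lindex x xs :=
  match xs with
  | x :: _ => constr:(Some 0%N)
  | ?y :: _ =>
    let _ := match goal with _ => unify x y end in constr:(Some 0%N)
  | _ :: ?t =>
    lazymatch lindex x t with
    | Some ?n => constr:(Some (S n))
    | None => constr:(@None nat)
    end
  | nil => constr:(@None nat)
  end.

Ltac latoms xs e :=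
  lazymatch e with
  | @GRing.add _ ?a ?b => let xs := latoms xs a in latoms xs b
  | @GRing.opp _ ?a => latoms xs a
  | @GRing.scale _ _ _ ?a => latoms xs a
  | @GRing.zero _ => xs
  | ?x => lazymatch lindex x xs with
          | Some _ => xs
          | None => constr:(x :: xs)
          end
  end.

Ltac lreify F xs e :=
  lazymatch e with
  | @GRing.add _ ?a ?b =>
    let a' := lreify F xs a in let b' := lreify F xs b in
    constr:(@LAdd F a' b')
  | @GRing.opp _ ?a => let a' := lreify F xs a in constr:(@LOpp F a')
  | @GRing.scale _ _ ?c ?a => let a' := lreify F xs a in constr:(@LScale F c a')
  | @GRing.zero _ => constr:(@LZero F)
  | ?x => lazymatch lindex x xs with Some ?n => constr:(@LAtom F n) end
  end.

(* Reduces an equation between linear combinations in an [lmodType] over [F] to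
   the equations between the coefficients of each vector. *)
Ltac lmod_coefs F :=
  lazymatch goal with
  | |- @eq ?T ?l ?r =>
    let xs := latoms (@nil T) l in
    let xs := latoms xs r in
    let e := lreify F xs l in
    let e' := lreify F xs r in
    apply: (@lcomb_eq F _ xs e e');
    [ vm_compute; reflexivity | vm_compute; reflexivity
    | cbv beta iota delta [size lcomb_eqs lcomb_coef Nat.eqb]; do ?split ]
  end.

(** * Integer scalars and the calculus of superbrackets *)

Lemma intr_neq0 (F : fieldType) (k : int) :
  [pchar F] =i pred0 -> k != 0 -> k%:~R != 0 :> F.
Proof.
move=> /pcharf0P h; case: k => n hn; first by rewrite -pmulrn h.
by rewrite NegzE mulrNz oppr_eq0 -pmulrn h.
Qed.

(* The axioms of a Lie superalgebra, except that the even and odd parts may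
   meet: this is what survives in the quotient by a non-graded ideal. *)
Record super_bracket (F : fieldType) (V : lmodType F) (br : V -> V -> V)
    (hom : bool -> V -> Prop) : Prop := SuperBracket {
  sb_hlin : forall p (c : F) x y, hom p x -> hom p y -> hom p (c *: x + y);
  sb_linl : forall (c : F) x y z, br (c *: x + y) z = c *: br x z + br y z;
  sb_linr : forall (c : F) x y z, br z (c *: x + y) = c *: br z x + br z y;
  sb_hom : forall p q x y, hom p x -> hom q y -> hom (p (+) q) (br x y);
  sb_skew : forall p q x y, hom p x -> hom q y ->
    br x y = - ((-1) ^+ (p && q) *: br y x);
  sb_jacobi : forall p q x y z, hom p x -> hom q y ->
    br x (br y z) = br (br x y) z + (-1) ^+ (p && q) *: br y (br x z) }.

Section SuperBracketTheory.
Variables (F : fieldType) (V : lmodType F) (br : V -> V -> V).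
Variables (hom : bool -> V -> Prop) (sb : super_bracket br hom).

Lemma sbDl x y z : br (x + y) z = br x z + br y z.
Proof. by have := sb_linl sb 1 x y z; rewrite !scale1r. Qed.
Lemma sbDr x y z : br z (x + y) = br z x + br z y.
Proof. by have := sb_linr sb 1 x y z; rewrite !scale1r. Qed.
Lemma sb0l z : br 0 z = 0.
Proof. by apply: (addIr (br 0 z)); rewrite -sbDl !add0r. Qed.
Lemma sb0r z : br z 0 = 0.
Proof. by apply: (addIr (br z 0)); rewrite -sbDr !add0r. Qed.
Lemma sbZl c x z : br (c *: x) z = c *: br x z.
Proof. by have := sb_linl sb c x 0 z; rewrite !addr0 sb0l addr0. Qed.
Lemma sbZr c x z : br z (c *: x) = c *: br z x.
Proof. by have := sb_linr sb c x 0 z; rewrite !addr0 sb0r addr0. Qed.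
Lemma sbNl x z : br (- x) z = - br x z.
Proof. by rewrite -scaleN1r sbZl scaleN1r. Qed.
Lemma sbNr x z : br z (- x) = - br z x.
Proof. by rewrite -scaleN1r sbZr scaleN1r. Qed.
Definition sbE := (sbDl, sbDr, sbZl, sbZr, sbNl, sbNr, sb0l, sb0r).

Lemma sb_hZ p (c : F) x : hom p x -> hom p (c *: x).
Proof.
move=> h; have h0 : hom p 0 by rewrite -(addNr x) -scaleN1r; apply: (sb_hlin sb).
by rewrite -[c *: x]addr0; apply: (sb_hlin sb).
Qed.
Lemma sb_hN p x : hom p x -> hom p (- x).
Proof. by rewrite -scaleN1r; apply: sb_hZ. Qed.

Lemma sb_jac p q x y z : hom p x -> hom q y -> p && q = false ->
  br x (br y z) = br (br x y) z + br y (br x z).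
Proof. by move=> hx hy e; rewrite (sb_jacobi sb _ hx hy) e scale1r. Qed.
Lemma sb_jac_odd x y z : hom true x -> hom true y ->
  br x (br y z) = br (br x y) z - br y (br x z).
Proof. by move=> hx hy; rewrite (sb_jacobi sb _ hx hy) scaleN1r. Qed.
Lemma sb_anti p q x y : hom p x -> hom q y -> p && q = false ->
  br x y = - br y x.
Proof. by move=> hx hy e; rewrite (sb_skew sb hx hy) e scale1r. Qed.
Lemma sb_sym x y : hom true x -> hom true y -> br x y = br y x.
Proof. by move=> hx hy; rewrite (sb_skew sb hx hy) scaleN1r opprK. Qed.
Lemma sb_ad2 x y : hom true x -> br (br x x) y = 2 *: br x (br x y).
Proof.
by move=> hx; rewrite scaler_nat mulr2n {1}(sb_jac_odd _ hx hx) subrK.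
Qed.

End SuperBracketTheory.

Lemma lie_super_bracket (F : fieldType) (L : lieSuperType F) :
  super_bracket (@lbr F L) (@homog F L).
Proof.
by split=> *; [exact: homog_lin|exact: lbr_linl|exact: lbr_linr|
  exact: homog_lbr|exact: lbr_skew|exact: lbr_jacobi].
Qed.

(** * Vanishing of the obstructions [X], [Y], [Z] in nonnegative weights *)

Section Tower.
Variables (F : fieldType) (charF : [pchar F] =i pred0).
Variables (V : lmodType F) (br : V -> V -> V) (hom : bool -> V -> Prop).
Variables (sb : super_bracket br hom) (A B C D : int -> V) (p q : V).

Local Notation b := (B 0).
Let X i j := br (D i) (D j).
Let Y i j := br (B i) (D j) + C (i + j).
Let Z i j := br (B i) (B j) + A (i + j).

Hypothesis CE : forall k, C k = - br b (D k).
Hypothesis AE : forall k, A k = - br b (B k).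
Hypothesis hB : forall k, hom true (B k).
Hypothesis hD : forall k, hom false (D k).
Hypothesis hp : hom true p.
Hypothesis hq : hom true q.
Hypothesis pD : forall k, br p (D k) = B (k + 1).
Hypothesis pB : forall k, br p (B k) = (k%:~R - 2^-1) *: D k.
Hypothesis qD : forall k, br q (D k) = B k.
Hypothesis qB : forall k, br q (B k) = (k%:~R + 2^-1) *: D (k - 1).
Hypothesis pE : p = C 0.
Hypothesis bbD : forall k, br b (br b (D k)) = (k%:~R + 2^-1) *: D k.
Hypothesis bbB : forall k, br b (br b (B k)) = k%:~R *: B k.
(* These relations, and their mirror images, are the only ones that the
   induction on the weight does not produce by itself. *)
Hypothesis X0N1 : X 0 (- 1) = 0.
Hypothesis X01 : X 0 1 = 0.
Hypothesis Y10 : Y 1 0 = 0.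
Hypothesis Y12 : Y 1 2 = 0.

Let two_neq0 : 2%:R != 0 :> F.
Proof. by have := charF 2; rewrite !inE /= => ->. Qed.
Let sbE := sbE sb.
Let intF (k : int) : k != 0 -> k%:~R != 0 :> F.
Proof. exact: intr_neq0. Qed.

(** Doubling clears the half-integers met below, so that cancelling a scalar becomes a question
    about an integer. *)
Let cancelZ (m : int) (c : F) (x : V) :
  2 * c = m%:~R -> m != 0 -> c *: x = 0 -> x = 0.
Proof.
move=> e /intF; rewrite -e mulf_eq0 (negbTE two_neq0) orFb => c0 /eqP.
by rewrite scaler_eq0 (negbTE c0) => /eqP.
Qed.

Let Y0 k : Y 0 k = 0. Proof. by rewrite /Y add0r CE addrN. Qed.
Let Z0 k : Z 0 k = 0. Proof. by rewrite /Z add0r AE addrN. Qed.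
Let XC i j : X i j = - X j i.
Proof. exact: (sb_anti sb (hD i) (hD j)). Qed.
Let Xii i : X i i = 0.
Proof.
apply/eqP; have := XC i i => /eqP; rewrite -addr_eq0 -mulr2n -scaler_nat.
by rewrite scaler_eq0 (negbTE two_neq0).
Qed.
Let ZC i j : Z i j = Z j i.
Proof. by rewrite /Z (sb_sym sb (hB i) (hB j)) [i + j]addrC. Qed.
Let DB i j : br (D i) (B j) = C (j + i) - Y j i.
Proof. by rewrite (sb_anti sb (hD i) (hB j)) // /Y opprD addrCA addrN addr0. Qed.
Let BD i j : br (B i) (D j) = Y i j - C (i + j). Proof. by rewrite /Y addrK. Qed.
Let BB i j : br (B i) (B j) = Z i j - A (i + j). Proof. by rewrite /Z addrK. Qed.

Let jpB k y : br p (br (B k) y) = br (br p (B k)) y - br (B k) (br p y).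
Proof. exact: (sb_jac_odd sb _ hp (hB k)). Qed.
Let jpD k y : br p (br (D k) y) = br (br p (D k)) y + br (D k) (br p y).
Proof. exact: (sb_jac sb _ hp (hD k)). Qed.
Let jqB k y : br q (br (B k) y) = br (br q (B k)) y - br (B k) (br q y).
Proof. exact: (sb_jac_odd sb _ hq (hB k)). Qed.
(** [C] and [A] are brackets with [b], so here and in [pA] and [qC] they transform as in the model
    only up to an obstruction. These corrections become the last terms of [pY], [pZ] and [qY]. *)
Let pC k : br p (C k) = 2^-1 *: X 0 k - A (k + 1).
Proof.
rewrite CE sbE jpB pB pD !sbE -/(X 0 k) AE.
by lmod_coefs F; ring.
Qed.

Let pA k : br p (A k) = (1 - k%:~R) *: C k - 2^-1 *: Y k 0.
Proof.
rewrite AE sbE jpB !pB !sbE DB addr0 CE.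
by lmod_coefs F; field.
Qed.

Let qC k : br q (C k) = - 2^-1 *: X (- 1) k - A k.
Proof.
rewrite CE sbE jqB qB sub0r qD !sbE -/(X _ k) AE.
by lmod_coefs F; ring.
Qed.

(** Here and in [pY], [pZ], [qY], obstructions go to obstructions, [p] raising the weight by 1 and
    [q] lowering it by 1. Vanishing in one weight thus gives linear relations in the next. *)
Let pX i j : br p (X i j) = Y (i + 1) j - Y (j + 1) i.
Proof.
rewrite /X jpD !pD BD DB; have -> : j + 1 + i = i + 1 + j by lia.
by lmod_coefs F; ring.
Qed.

Let pY i j : br p (Y i j) =
  (i%:~R - 2^-1) *: X i j - Z i (j + 1) + 2^-1 *: X 0 (i + j).
Proof.
rewrite {1}/Y sbE jpB pB pD pC BB !sbE -/(X i j) [i + (j + 1)]addrA.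
by lmod_coefs F; ring.
Qed.

Let pZ i j : br p (Z i j) = - (i%:~R - 2^-1) *: Y j i
  - (j%:~R - 2^-1) *: Y i j - 2^-1 *: Y (i + j) 0.
Proof.
rewrite {1}/Z sbE jpB !pB pA !sbE DB BD [j + i]addrC.
by lmod_coefs F; field.
Qed.

Let qY i j : br q (Y i j) =
  (i%:~R + 2^-1) *: X (i - 1) j - Z i j - 2^-1 *: X (- 1) (i + j).
Proof.
rewrite {1}/Y sbE jqB qB qD qC BB !sbE -/(X _ j).
by lmod_coefs F; ring.
Qed.


(* In the weights 0 and 1 (in t), one relation leads to the next by applying
   alternately [ad p], which raises the weight by 1, and [ad q], which lowers
   it by 1. *)
Let zigzag (k : int) : (0 <= k)%R -> X k (-1 - k) = 0 -> Y (- k) k = 0 ->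
  [/\ Y (k + 1) (- 1 - k) = 0, Z (k + 1) (- 1 - k) = 0,
      Y (- 1 - k) (k + 1) = 0 & X (k + 1) (- 2 - k) = 0].
Proof.
move=> k0 hX hY.
have h1 : Y (k + 1) (- 1 - k) = 0.
  have := pX k (- 1 - k); rewrite hX sbE (_ : - 1 - k + 1 = - k); last by lia.
  by rewrite hY subr0.
have h2 : Z (k + 1) (- 1 - k) = 0.
  have := qY (k + 1) (- 1 - k); rewrite h1 sbE addrK hX (_ : k + 1 + _ = 0); last by lia.
  rewrite (XC (- 1)) X0N1 oppr0 !scaler0 sub0r subr0 => /esym/eqP.
  by rewrite oppr_eq0 => /eqP.
have h3 : Y (- 1 - k) (k + 1) = 0.
  have := pZ (k + 1) (- 1 - k); rewrite h2 h1 sbE (_ : k + 1 + _ = 0); last by lia.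
  rewrite Y0 !scaler0 !subr0 => /esym.
  by apply: (@cancelZ (- (2 * k + 1))); [field | lia].
split=> //; have := qY (- 1 - k) (k + 1).
rewrite h3 ZC h2 sbE (_ : - 1 - k + (k + 1) = 0); last by lia.
rewrite (XC (- 1)) X0N1 oppr0 !scaler0 !subr0 (_ : - 1 - k - 1 = - 2 - k); last by lia.
rewrite [X (- 2 - k) _]XC scalerN -scaleNr addr0 => /esym.
by apply: (@cancelZ (2 * k + 1)); [field | lia].
Qed.

Let zigzag_nat (n : nat) : X n%:Z (- 1 - n%:Z) = 0 /\ Y (- n%:Z) n%:Z = 0.
Proof.
elim: n => [|n [hX hY]]; first by rewrite subr0 oppr0 X0N1 Y0.
have [_ _ h3 h4] := zigzag (isT : (0 <= n%:Z)%R) hX hY.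
by split; [rewrite -h4 | rewrite -h3]; congr (_ _ _); lia.
Qed.

(** In powers of t, [X i j] has weight 2(i + j + 1), [Y i j] has 2(i + j) + 1 and [Z i j] has 2(i +
    j), so [flat n] covers the weights 2n and 2n + 1. *)
Let flat (n : int) := [/\ forall i j : int, i + j + 1 = n -> X i j = 0,
  forall i j : int, i + j = n -> Y i j = 0 &
  forall i j : int, i + j = n -> Z i j = 0].

Let flat0 : flat 0.
Proof.
have S n := let: conj h h' := zigzag_nat n in zigzag (isT : (0 <= n%:Z)%R) h h'.
split.
- have P (n : nat) j : n%:Z + j + 1 = 0 -> X n j = 0.
    by move=> e; rewrite (_ : j = - 1 - n%:Z); [case: (zigzag_nat n)|lia].
  case=> n j e; first exact: P.
  case: j e => j e; last by lia.
  by rewrite XC P ?oppr0 //; lia.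
- case=> [[|n]|n] j e; first by rewrite Y0.
    have [h _ _ _] := S n; rewrite -h; congr (Y _ _); lia.
  have [_ h] := zigzag_nat n.+1; rewrite -h; congr (Y _ _); lia.
- have P (n : nat) j : n.+1%:Z + j = 0 -> Z n.+1 j = 0.
    move=> e; have [_ h _ _] := S n; rewrite -h; congr (Z _ _); lia.
  case=> [[|n]|n] j e; [by rewrite Z0|exact: P|].
  have -> : j = n.+1%:Z by lia.
  by rewrite ZC P //; lia.
Qed.

Let hA k : hom false (A k).
Proof. by rewrite AE; exact: (sb_hN sb (sb_hom sb (hB 0) (hB k))). Qed.
Let hC k : hom true (C k).
Proof. by rewrite CE; exact: (sb_hN sb (sb_hom sb (hB 0) (hD k))). Qed.
(** Since p is [C 0], [pC] at 0 gives [A 1 = - br p p]. The action of t^2 is thereby known on [B]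
    and [D] without using any further relation. *)
Let A1E x : br (A 1) x = - 2 *: br p (br p x).
Proof.
have -> : A 1 = - br p p by rewrite {2}pE pC Xii scaler0 sub0r add0r opprK.
by rewrite sbE (sb_ad2 sb _ hp) scaleNr.
Qed.
Let bC k : br b (C k) = - (k%:~R + 2^-1) *: D k.
Proof. by rewrite CE sbE bbD scaleNr. Qed.
Let bA k : br b (A k) = - k%:~R *: B k.
Proof. by rewrite AE sbE bbB scaleNr. Qed.
(** Carries [B 1] past the [b] in the definitions of [C] and [A], which yields [B1C] and [B1A]. *)
Let B1b x : br (B 1) (br b x) = - br (A 1) x - br b (br (B 1) x).
Proof.
rewrite (sb_jac_odd sb _ (hB 1) (hB 0)) (sb_sym sb (hB 1) (hB 0)).
by rewrite AE sbE opprK.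
Qed.
Let B1C k : Y 1 k = 0 -> br (B 1) (C k) = (2^-1 - k%:~R) *: D (k + 1).
Proof.
move=> y0; rewrite CE sbE B1b A1E pD pB BD y0 sub0r sbE bC [1 + k]addrC.
by lmod_coefs F; field.
Qed.
Let B1A k : Z 1 k = 0 -> br (B 1) (A k) = (2 - k%:~R) *: B (k + 1).
Proof.
move=> z0; rewrite AE sbE B1b A1E pB sbE pD BB z0 sub0r sbE bA [1 + k]addrC.
by lmod_coefs F; field.
Qed.
Let B1D k : Y 1 k = 0 -> br (B 1) (D k) = - C (k + 1).
Proof. by move=> y0; rewrite BD y0 sub0r addrC. Qed.
Let jB1 r x y : hom r x ->
  br (B 1) (br x y) = br (br (B 1) x) y + (-1) ^+ r *: br x (br (B 1) y).
Proof. exact: (sb_jacobi sb y (hB 1)). Qed.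

(* The next two identities come from applying [ad (B 1)] twice, which is the
   action of - t^4 / 2, to a relation of weight smaller by 4. *)
Let X2E m : X 0 m = 0 -> Y 1 1 = 0 -> Y 1 m = 0 -> Y 1 (m + 1) = 0 ->
  X 2 m = - (2 * m%:~R + 1) *: X 0 (m + 2).
Proof.
move=> x0 y1 y2 y3; have := congr1 (fun x => br (B 1) (br (B 1) x)) x0.
rewrite /X (jB1 _ (hD 0)) !B1D // add0r !sbE (jB1 _ (hC 1)) (jB1 _ (hD 0)).
rewrite !B1C // !B1D // !sbE -/(X _ _) -(addrA m 1 1) -/(X 0 _) => e.
by apply: (lincomb 2 e); lmod_coefs F; field.
Qed.

Let Y4E m : Z 1 2 = 0 -> Z 1 3 = 0 ->
  Y 2 m = 0 -> Y 1 m = 0 -> Y 1 (m + 1) = 0 -> Y 1 (m + 2) = 0 ->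
  2 *: Y 4 m + (2 * m%:~R + 1) *: Y 2 (m + 2)
    - (2 * m%:~R + 3) *: Y 1 (m + 3) = 0.
Proof.
move=> z2 z3 y0 y1 y2 y3.
have := congr1 (fun x => br (B 1) (br (B 1) x)) y0.
rewrite {1}/Y sbE (jB1 _ (hB 2)) BB z2 sub0r B1D // (addrC 2 m) B1C // !sbE.
rewrite (jB1 _ (hA 3)) (jB1 _ (hB 2)) (B1A z3) BB z2 sub0r (B1D y1) (B1C y2).
rewrite -!(addrA m) !sbE !BD (addrC 4 m) (addrC 2 (m + 2)) (addrC 1 (m + 3)).
rewrite -!(addrA m) => e.
by apply: (lincomb 2 e); lmod_coefs F; field.
Qed.

(** Below, the coefficients are odd integers, so the recurrences never break off and a single zero
    spreads both ways. *)
Let chain (g : int -> V) (u v : int -> int) i0 :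
  (forall i, u i != 0) -> (forall i, v i != 0) ->
  (forall i, (u i)%:~R *: g (i + 1) = (v i)%:~R *: g i) ->
  g i0 = 0 -> forall i, g i = 0.
Proof.
move=> u0 v0 e g0.
have c (m : int) x : m != 0 -> m%:~R *: x = 0 -> x = 0 :> V.
  by move=> m0 /eqP; rewrite scaler_eq0 (negbTE (intF m0)) => /eqP.
have up (n : nat) : g (i0 + n%:Z) = 0.
  elim: n => [|n ih]; first by rewrite addr0.
  have := e (i0 + n%:Z); rewrite ih scaler0 => /(c _ _ (u0 _)) <-; congr g; lia.
have down (n : nat) : g (i0 - n%:Z) = 0.
  elim: n => [|n ih]; first by rewrite subr0.
  have := e (i0 - n.+1%:Z); rewrite (_ : _ + 1 = i0 - n%:Z); last by lia.
  by rewrite ih scaler0 => /esym/(c _ _ (v0 _)).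
move=> i; case: (boolP (i0 <= i)) => h.
  by have -> : i = i0 + `|i - i0|%N%:Z by lia.
by have -> : i = i0 - `|i - i0|%N%:Z by lia.
Qed.

Let stepX (n : int) : 1 <= n -> (forall m, 0 <= m < n -> flat m) ->
  (forall i j : int, i + j + 1 = n -> X i j = 0) /\
  (forall i j : int, i + j = n -> Z i j = 0).
Proof.
move=> n1 below.
have bX (i j : int) : 0 <= i + j + 1 < n -> X i j = 0.
  by move=> h; case: (below _ h) => hX _ _; apply: hX.
have bY (i j : int) : 0 <= i + j < n -> Y i j = 0.
  by move=> h; case: (below _ h) => _ hY _; apply: hY.
(* This is [pY], where [Y i j] has weight 2n - 1 and already vanishes. *)
have Zrel (i j : int) : i + j + 1 = n ->
    Z i (j + 1) = (i%:~R - 2^-1) *: X i j + 2^-1 *: X 0 (n - 1).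
  move=> e; have := pY i j; rewrite bY ?sbE; last by lia.
  rewrite (_ : i + j = n - 1); last by lia.
  by move=> h; apply: (lincomb 1 h); lmod_coefs F; ring.
(* The symmetry of [Z], with both sides expressed through [Zrel]. *)
have Xrel (i : int) : (2 * i + 1)%:~R *: X (i + 1) (n - 1 - (i + 1))
    = (- (2 * (n - 2 - i) + 1))%:~R *: X i (n - 1 - i).
  have h1 : Z (i + 1) (n - 2 - i + 1) = _ := Zrel (i + 1) (n - 2 - i) ltac:(lia).
  have h2 : Z (n - 2 - i + 1) (i + 1) = _ := Zrel (n - 2 - i + 1) i ltac:(lia).
  have h : _ = _ := ZC (i + 1) (n - 2 - i + 1).
  rewrite h1 h2 [X (n - 2 - i + 1) i]XC in h.
  have -> : n - 1 - (i + 1) = n - 2 - i by lia.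
  have -> : n - 1 - i = n - 2 - i + 1 by lia.
  by apply: (lincomb 2 h); lmod_coefs F; field.
(* One zero now suffices. For odd n antisymmetry puts it in the middle; for n = 2 it is [X01]. *)
have [m hm] : exists m : int, X m (n - 1 - m) = 0.
  have [[m hm]|[m hm]] : (exists m : int, n = 2 * m + 1) \/ (exists m : int, n = 2 * m).
    by case: (boolP (odd `|n|%N)) => o; [left|right]; exists (`|n|%N./2)%:Z; lia.
    by exists m; rewrite (_ : _ - m = m) ?Xii //; lia.
  exists 0; rewrite subr0.
  have [->//|n4] : n = 2 \/ 4 <= n by lia.
  have h := @X2E (n - 3) (bX 0 (n - 3) ltac:(lia)) (bY 1 1 ltac:(lia))
    (bY 1 (n - 3) ltac:(lia)) (bY 1 (n - 3 + 1) ltac:(lia)).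
  have := Xrel 0; have := Xrel 1.
  rewrite (_ : n - 3 + 2 = n - 1) in h; last by lia.
  rewrite !add0r !subr0 (_ : n - 1 - (1 + 1) = n - 3); last by lia.
  (* Eliminating [X 1 (n - 2)] and [X 2 (n - 3)] between [X2E] and the recurrence at 0 and 1 leaves
     2n(2n - 5) times [X 0 (n - 1)]. *)
  move=> r1 r0; apply: (@cancelZ (4 * n * (2 * n - 5)) (2 * n%:~R * (2 * n%:~R - 5))).
  - by ring.
  - by rewrite !mulf_neq0 //; lia.
  apply: (lincomb 3 h); apply: (lincomb (-1) r1).
  apply: (lincomb (2 * n%:~R - 5) r0).
  by lmod_coefs F; ring.
have hX (i j : int) : i + j + 1 = n -> X i j = 0.
  move=> e; rewrite (_ : j = n - 1 - i); last by lia.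
  apply: (@chain (fun i => X i (n - 1 - i)) _ _ m _ _ Xrel hm) => k; lia.
split=> // i j e; rewrite -(subrK 1 j) Zrel; last by lia.
by rewrite !hX ?scaler0 ?addr0 //; lia.
Qed.

Let stepY (n : int) : 1 <= n -> (forall m, 0 <= m < n -> flat m) ->
  forall i j : int, i + j = n -> Y i j = 0.
Proof.
move=> n1 below; have [hX hZ] := stepX n1 below.
have bY (i j : int) : 0 <= i + j < n -> Y i j = 0.
  by move=> h; case: (below _ h) => _ hY _; apply: hY.
have bZ (i j : int) : 0 <= i + j <= n -> Z i j = 0.
  move=> h; have [e|ne] := eqVneq (i + j) n; first exact: hZ.
  have h' : 0 <= i + j < n by lia.
  by case: (below _ h') => _ _ hZ'; apply: hZ'.
have Ysym (i j : int) : i + j + 1 = n -> Y (i + 1) j = Y (j + 1) i.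
  by move=> e; have := pX i j; rewrite hX // sbE => /esym/eqP; rewrite subr_eq0 => /eqP.
have Yrec (i : int) : (2 * i%:~R - 1) *: Y (i + 1) (n - (i + 1))
    + (2 * (n - i)%:~R - 1) *: Y i (n - i) + Y 1 (n - 1) = 0.
  have h := pZ i (n - i); rewrite hZ ?sbE in h; last by lia.
  have e1 : Y (i + 1) (n - (i + 1)) = Y (n - i) i.
    by rewrite Ysym; [congr (Y _ _)|]; lia.
  have e2 : Y 1 (n - 1) = Y (i + (n - i)) 0.
    have := Ysym 0 (n - 1) ltac:(lia); rewrite add0r => ->.
    by congr (Y _ _); lia.
  by rewrite e1 e2; apply: (lincomb 2 h); lmod_coefs F; field.
(* The recurrence [Yrec] has the constant term [Y 1 (n - 1)]. The hypothesis on k makes it a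
   constant solution, so one agreement spreads to all i, and [Y 0 n = 0] forces k = 0. *)
have conclude (k : V) (m : int) :
    (2 * n%:~R - 2) *: k = - Y 1 (n - 1) -> Y m (n - m) = k ->
    forall i : int, Y i (n - i) = 0.
  move=> e hm; have g (i : int) : Y i (n - i) - k = 0.
    apply: (@chain (fun i => Y i (n - i) - k) (fun i => 2 * i - 1)
      (fun i => - (2 * (n - i) - 1)) m) => [j|j|j|]; [lia|lia| |].
      apply: (lincomb 1 (Yrec j)); apply: (lincomb (- 1) e).
      by lmod_coefs F; ring.
    by rewrite hm subrr.
  by move=> i; have := g 0; have := g i; rewrite Y0 sub0r => + /eqP;
    rewrite oppr_eq0 => + /eqP k0; rewrite k0 subr0.
have {}conclude : forall i : int, Y i (n - i) = 0.
  (* For odd n, killing [Y 1 (n - 1)] allows k = 0. For even n the two middle terms agree by [Ysym],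
     and their common value serves as k. *)
  have [[m hm]|[m hm]] : (exists m : int, n = 2 * m + 1) \/ (exists m : int, n = 2 * m).
    by case: (boolP (odd `|n|%N)) => o; [left|right]; exists (`|n|%N./2)%:Z; lia.
    suff y1 : Y 1 (n - 1) = 0.
      by apply: (conclude 0 0); rewrite ?y1 ?oppr0 ?scaler0 ?Y0.
    have [->//|[->//|n5]] : n = 1 \/ n = 3 \/ 5 <= n by lia.
    have h := @Y4E (n - 4) (bZ 1 2 ltac:(lia)) (bZ 1 3 ltac:(lia))
      (bY 2 (n - 4) ltac:(lia)) (bY 1 (n - 4) ltac:(lia))
      (bY 1 (n - 4 + 1) ltac:(lia)) (bY 1 (n - 4 + 2) ltac:(lia)).
    rewrite (_ : n - 4 + 2 = n - 2) in h; last by lia.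
    rewrite (_ : n - 4 + 3 = n - 1) in h; last by lia.
    have := Yrec 1; have := Yrec 2; have := Yrec 3.
    move=> r3 r2 r1.
    (* This scalar remains on [Y 1 (n - 1)] after eliminating the terms with first index 2, 3 and 4
       between [Y4E] and [Yrec] at 1, 2, 3. Both 2n - 1 and 8n^2 - 22n - 15 are odd, hence
       nonzero. *)
    apply: (@cancelZ (2 * (2 * n - 1) * (8 * (n * n) - 22 * n - 15))
       ((2 * n%:~R - 1) * (8 * (n%:~R * n%:~R) - 22 * n%:~R - 15))).
    - by ring.
    - rewrite !mulf_neq0 //; first by lia.
      by move: (n * n) => t; lia.
    apply: (lincomb (- 15) h); apply: (lincomb 6 r3).
    apply: (lincomb (- 2 * (2 * n%:~R - 7)) r2).
    apply: (lincomb ((2 * n%:~R - 7) * (4 * n%:~R + 5)) r1).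
    by lmod_coefs F; ring.
  apply: (conclude (Y m (n - m)) m) => //.
  have s : Y (m + 1) (n - (m + 1)) = Y m (n - m).
    have := Ysym m (m - 1) ltac:(lia); rewrite subrK => h.
    have -> : n - m = m by lia.
    by have -> : n - (m + 1) = m - 1 by lia.
  have := Yrec m; rewrite s => h.
  by apply: (lincomb 1 h); rewrite hm; lmod_coefs F; ring.
by move=> i j e; rewrite -(conclude i); congr (Y _ _); lia.
Qed.

Let flatP (n : nat) : flat n%:Z.
Proof.
elim/ltn_ind: n => -[_|n ih]; first exact: flat0.
have below m : 0 <= m < n.+1%:Z -> flat m.
  by case: m => m // h; apply: ih; lia.
have n1 : 1 <= n.+1%:Z by lia.
by have [hX hZ] := stepX n1 below; split=> //; apply: stepY.
Qed.

Lemma tower_DD (i j : int) : 0 <= i + j + 1 -> br (D i) (D j) = 0.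
Proof.
move=> h; have [n e] : exists n : nat, i + j + 1 = n by exists `|(i + j + 1)%R|%N; lia.
by have [hX _ _] := flatP n; apply: hX.
Qed.

Lemma tower_BD (i j : int) : 0 <= i + j -> br (B i) (D j) = br b (D (i + j)).
Proof.
move=> h; have [n e] : exists n : nat, i + j = n by exists `|(i + j)%R|%N; lia.
have [_ hY _] := flatP n; have := hY i j e.
by rewrite /Y CE => /eqP; rewrite subr_eq0 => /eqP.
Qed.

End Tower.

(** * One half of an osp(1|2)-module, built from its middle *)

Section Ladder.
Variables (F : fieldType) (charF : [pchar F] =i pred0).
Variables (V : lmodType F) (br : V -> V -> V) (hom : bool -> V -> Prop).
Variables (sb : super_bracket br hom).
Implicit Types (n : nat) (s : F).

Let two_neq0 : 2%:R != 0 :> F.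
Proof. by have := charF 2; rewrite !inE /= => ->. Qed.
Let odd_neq0 n : 2 * n%:R + 1 != 0 :> F.
Proof. by rewrite -natrM natr1; have /pcharf0P -> := charF. Qed.

(** The sign s is 1 for the upward ladder and -1 for the downward one, where p and q trade roles.
    The scalar inverts s(2m + 1)/2, the coefficient that [ladder_pB] requires. *)
Fixpoint ladder (p b d : V) s n : V * V :=
  if n is m.+1 then
    let B := br p (ladder p b d s m).2 in
    (B, (2 * s / (2 * m + 1)%:R) *: br p B)
  else (b, d).

Variables (p q b d : V) (s : F).
Hypotheses (hp : hom true p) (hq : hom true q) (hb : hom true b) (hd : hom false d).
Hypothesis ss : s * s = 1.
Hypothesis pb : br p b = - (s / 2) *: d.
Hypothesis qd : br q d = b.
Hypothesis wp : br (br p q) p = s *: p.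
Hypothesis wb : br (br p q) b = 0.
Hypothesis wd : br (br p q) d = s *: d.

Let B n := (ladder p b d s n).1.
Let D n := (ladder p b d s n).2.

Lemma ladder_hom n : hom true (B n) /\ hom false (D n).
Proof.
rewrite /B /D; elim: n => //= n [_ h].
have h' := sb_hom sb hp h; split=> //.
by apply: (sb_hZ sb); apply: (sb_hom sb hp h').
Qed.

Lemma ladder_pD n : br p (D n) = B n.+1. Proof. by []. Qed.

Lemma ladder_pB n : br p (B n) = (s * (n%:R - 2^-1)) *: D n.
Proof.
case: n => [|n]; first by rewrite pb; congr (_ *: _); ring.
rewrite /B /D /= scalerA.
have -> : s * (n.+1%:R - 2^-1) * (2 * s / (2 * n + 1)%:R) = s * s.
  by field; rewrite odd_neq0 two_neq0.
by rewrite ss scale1r.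
Qed.

Let hpq : hom false (br p q). Proof. exact: (sb_hom sb hp hq). Qed.

(** The bracket of p and q acts as the grading operator, and each application of p shifts its
    eigenvalue by s. *)
Lemma ladder_weight n : br (br p q) (B n) = (s * (2 * n%:R)) *: B n /\
  br (br p q) (D n) = (s * (2 * n%:R + 1)) *: D n.
Proof.
have wpr x : br (br p q) (br p x) = s *: br p x + br p (br (br p q) x).
  by rewrite (sb_jac sb _ hpq hp) // wp (sbE sb).
elim: n => [|n [_ ih]].
  by rewrite /B /D /= wb wd; split; lmod_coefs F; ring.
have hB : br (br p q) (B n.+1) = (s * (2 * n.+1%:R)) *: B n.+1.
  by rewrite -ladder_pD wpr ih (sbE sb); lmod_coefs F; ring.
by split=> //; rewrite /D /= (sbE sb) wpr hB (sbE sb); lmod_coefs F; ring.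
Qed.

Let qp x : br q (br p x) = br (br p q) x - br p (br q x).
Proof. by rewrite (sb_jac_odd sb _ hq hp) (sb_sym sb hq hp). Qed.

Lemma ladder_q n : br q (D n) = B n /\
  br q (B n.+1) = (s * (n%:R + 3 / 2)) *: D n.
Proof.
have step n' : br q (D n') = B n' -> br q (B n'.+1) = (s * (n'%:R + 3 / 2)) *: D n'.
  move=> h; have [_ w] := ladder_weight n'.
  by rewrite -ladder_pD qp w h ladder_pB; lmod_coefs F; field.
elim: n => [|n [_ h]]; first by split; [exact: qd | apply: step; exact: qd].
suff h' : br q (D n.+1) = B n.+1 by split=> //; apply: step.
have [w _] := ladder_weight n.+1.
rewrite {1}/D /= (sbE sb) qp w h (sbE sb) ladder_pD -scalerBl scalerA.
have -> : 2 * s / (2 * n + 1)%:R * (s * (2 * n.+1%:R) - s * (n%:R + 3 / 2)) = s * s.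
  by field; rewrite odd_neq0 two_neq0.
by rewrite ss scale1r.
Qed.

End Ladder.

(* The vectors [b], [d], [e] play the roles of xi_1, t xi_1 xi_2 and
   t^-1 xi_1 xi_2; then [- br b d] and [- br b e] are t xi_2 and t^-1 xi_2, and
   [br b b] is -1. *)
Record ramond_triple (F : fieldType) (V : lmodType F) (br : V -> V -> V)
    (hom : bool -> V -> Prop) (b d e p q : V) : Prop := RamondTriple {
  rt_hb : hom true b;
  rt_hd : hom false d;
  rt_he : hom false e;
  rt_p : p = - br b d;
  rt_q : q = - br b e;
  rt_bb : br b b = br p q;
  rt_pb : br p b = - 2^-1 *: d;
  rt_qb : br q b = 2^-1 *: e;
  rt_qd : br q d = b;
  rt_pe : br p e = b;
  rt_wp : br (br p q) p = p;
  rt_wq : br (br p q) q = - q;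
  rt_wb : br (br p q) b = 0;
  rt_wd : br (br p q) d = d;
  rt_we : br (br p q) e = - e }.

(** * The families [A], [B], [C], [D] in all weights *)

Section RamondFamilies.
Variables (F : fieldType) (charF : [pchar F] =i pred0).
Variables (V : lmodType F) (br : V -> V -> V) (hom : bool -> V -> Prop).
Variables (sb : super_bracket br hom) (b d e p q : V).
Hypothesis rt : ramond_triple br hom b d e p q.

Let two_neq0 : 2%:R != 0 :> F.
Proof. by have := charF 2; rewrite !inE /= => ->. Qed.

Local Notation up := (ladder br p b d 1).
Local Notation down := (ladder br q b e (- 1)).

(** Both ladders start from the same [b], of index 0, but the downward one has e, of index -1, where
    the upward one has d. As [Negz n] is -(n + 1), this accounts for the shift between [ramB] and
    [ramD]. *)
Definition ramB (k : int) : V :=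
  match k with Posz n => (up n).1 | Negz n => (down n.+1).1 end.
Definition ramD (k : int) : V :=
  match k with Posz n => (up n).2 | Negz n => (down n).2 end.
Definition ramC (k : int) : V := - br b (ramD k).
Definition ramA (k : int) : V := - br b (ramB k).

Let hb := rt_hb rt.
Let hp : hom true p.
Proof. by rewrite (rt_p rt); exact: (sb_hN sb (sb_hom sb hb (rt_hd rt))). Qed.
Let hq : hom true q.
Proof. by rewrite (rt_q rt); exact: (sb_hN sb (sb_hom sb hb (rt_he rt))). Qed.
Let pqC : br q p = br p q. Proof. exact: (sb_sym sb hq hp). Qed.

Let uph := ladder_hom sb 1 hp hb (rt_hd rt).
Let downh := ladder_hom sb (- 1) hq hb (rt_he rt).

Lemma ramB_hom k : hom true (ramB k).
Proof. by case: k => n; [case: (uph n) | case: (downh n.+1)]. Qed.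
Lemma ramD_hom k : hom false (ramD k).
Proof. by case: k => n; [case: (uph n) | case: (downh n)]. Qed.

Let one2 : 1 * 1 = 1 :> F. Proof. exact: mulr1. Qed.
Let mone2 : - 1 * - 1 = 1 :> F. Proof. by rewrite mulrNN mulr1. Qed.
Let pbE : br p b = - (1 / 2) *: d. Proof. by rewrite mul1r (rt_pb rt). Qed.
Let qbE : br q b = - (- 1 / 2) *: e.
Proof. by rewrite mulN1r opprK (rt_qb rt). Qed.
Let wpE : br (br p q) p = 1 *: p. Proof. by rewrite scale1r (rt_wp rt). Qed.
Let wdE : br (br p q) d = 1 *: d. Proof. by rewrite scale1r (rt_wd rt). Qed.
Let wqE : br (br q p) q = - 1 *: q.
Proof. by rewrite pqC scaleN1r (rt_wq rt). Qed.
Let weE : br (br q p) e = - 1 *: e.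
Proof. by rewrite pqC scaleN1r (rt_we rt). Qed.
Let wbE : br (br q p) b = 0. Proof. by rewrite pqC (rt_wb rt). Qed.

Let up_pB := ladder_pB charF one2 pbE.
Let down_qB := ladder_pB charF mone2 qbE.
Let up_q :=
  ladder_q charF sb hp hq one2 pbE (rt_qd rt) wpE (rt_wb rt) wdE.
Let down_p :=
  ladder_q charF sb hq hp mone2 qbE (rt_pe rt) wqE wbE weE.
Let up_w := ladder_weight sb hp hq wpE (rt_wb rt) wdE.
Let down_w := ladder_weight sb hq hp wqE wbE weE.

Lemma ram_pD k : br p (ramD k) = ramB (k + 1).
Proof.
case: k => n; first by have -> : n%:Z + 1 = n.+1 by lia.
have [h _] := down_p n; rewrite [LHS]h {h}; case: n => [|n] //.
by have -> : Negz n.+1 + 1 = Negz n by lia.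
Qed.

Lemma ram_qD k : br q (ramD k) = ramB k.
Proof. by case: k => n //=; have [-> _] := up_q n. Qed.

Lemma ram_pB k : br p (ramB k) = (k%:~R - 2^-1) *: ramD k.
Proof.
case: k => n; first by rewrite up_pB mul1r.
have [_ h] := down_p n; rewrite [LHS]h; congr (_ *: _).
by rewrite NegzE -[n.+1]addn1 PoszD rmorphN rmorphD /=; field.
Qed.

Lemma ram_qB k : br q (ramB k) = (k%:~R + 2^-1) *: ramD (k - 1).
Proof.
case: k => [[|n]|n]; first by rewrite add0r (rt_qb rt).
  have [_ h] := up_q n; rewrite [LHS]h; have -> : n.+1%:Z - 1 = n by lia.
  by congr (_ *: _); rewrite -[n.+1]addn1 PoszD rmorphD /=; field.
rewrite down_qB; have -> : Negz n - 1 = Negz n.+1 by lia.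
by congr (_ *: _); rewrite NegzE rmorphN /=; ring.
Qed.

Lemma ram_weight k : br (br p q) (ramB k) = (2 * k%:~R) *: ramB k /\
  br (br p q) (ramD k) = (2 * k%:~R + 1) *: ramD k.
Proof.
case: k => n; first by have [-> ->] := up_w n; rewrite !mul1r.
rewrite -pqC; have [-> _] := down_w n.+1; have [_ ->] := down_w n.
by split; congr (_ *: _); rewrite NegzE -[n.+1]addn1 PoszD rmorphN rmorphD ?natrD /=; ring.
Qed.

Let bb x : br b (br b x) = 2^-1 *: br (br p q) x.
Proof.
by rewrite -(rt_bb rt) (sb_ad2 sb _ hb) scalerA mulVf ?scale1r.
Qed.

Lemma ram_bbB k : br b (br b (ramB k)) = k%:~R *: ramB k.
Proof.
have [w _] := ram_weight k; rewrite bb w scalerA; congr (_ *: _).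
by field.
Qed.

Lemma ram_bbD k : br b (br b (ramD k)) = (k%:~R + 2^-1) *: ramD k.
Proof.
have [_ w] := ram_weight k; rewrite bb w scalerA; congr (_ *: _).
by field.
Qed.

Lemma ram_flat_up : br d e = 0 -> br d (ramD 1) = 0 ->
  br (ramB 1) d = - ramC 1 -> br (ramB 1) (ramD 2) = - ramC 3 ->
  (forall i j : int, 0 <= i + j + 1 -> br (ramD i) (ramD j) = 0) /\
  (forall i j : int, 0 <= i + j -> br (ramB i) (ramD j) = br b (ramD (i + j))).
Proof.
move=> x0 x1 y1 y3.
have y1' : br (ramB 1) (ramD 0) + ramC (1 + 0) = 0 by rewrite y1 addr0 addNr.
have y3' : br (ramB 1) (ramD 2) + ramC (1 + 2) = 0 by rewrite y3 addNr.
split=> i j h.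
  exact: (tower_DD charF sb (fun k => erefl (ramC k)) (fun k => erefl (ramA k))
    ramB_hom ramD_hom hp hq ram_pD ram_pB ram_qD ram_qB (rt_p rt)
    ram_bbD ram_bbB x0 x1 y1' y3').
exact: (tower_BD charF sb (fun k => erefl (ramC k)) (fun k => erefl (ramA k))
    ramB_hom ramD_hom hp hq ram_pD ram_pB ram_qD ram_qB (rt_p rt)
    ram_bbD ram_bbB x0 x1 y1' y3').
Qed.

(* The automorphism t |-> t^-1 of [L], which multiplies xi_1 and xi_2 by a
   square root of -1, exchanges positive and negative weights. *)
Lemma ram_flat_down (im : F) : im * im = - 1 ->
  br d e = 0 -> br e (ramD (- 2)) = 0 ->
  br (ramB (- 1)) e = - ramC (- 2) ->
  br (ramB (- 1)) (ramD (- 3)) = - ramC (- 4) ->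
  (forall i j : int, i + j + 1 <= 0 -> br (ramD i) (ramD j) = 0) /\
  (forall i j : int, i + j <= - 1 -> br (ramB i) (ramD j) = br b (ramD (i + j))).
Proof.
move=> im2 x0 x1 y1 y3.
have im0 : im != 0.
  by apply: contra_eq_neq im2 => ->; rewrite mul0r eq_sym oppr_eq0 oner_eq0.
(* The inverse of t^(2k+1) is t^(2(-1-k)+1), hence the index -1 - k for [D] and [C]. Up to the
   factor [im], p and q are exchanged. *)
pose B k := im *: ramB (- k); pose D k := ramD (- 1 - k).
pose C k := im *: ramC (- 1 - k); pose A k := - ramA (- k).
have hB k : hom true (B k) by apply: (sb_hZ sb); apply: ramB_hom.
have hp' := sb_hZ sb im hp; have hq' := sb_hZ sb im hq.
have CE k : C k = - br (B 0) (D k) by rewrite /B oppr0 (sbE sb) -scalerN.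
have AE k : A k = - br (B 0) (B k).
  by rewrite /A /B oppr0 !(sbE sb) scalerA im2 scaleN1r /ramA !opprK.
have qD k : br (im *: q) (D k) = B (k + 1).
  by rewrite (sbE sb) ram_qD /B; congr (_ *: ramB _); lia.
have qB k : br (im *: q) (B k) = (k%:~R - 2^-1) *: D k.
  rewrite !(sbE sb) ram_qB !scalerA im2 /D; have -> : - k - 1 = - 1 - k by lia.
  by congr (_ *: _); ring.
have pD k : br (im *: p) (D k) = B k.
  by rewrite (sbE sb) ram_pD /B; congr (_ *: ramB _); lia.
have pB k : br (im *: p) (B k) = (k%:~R + 2^-1) *: D (k - 1).
  rewrite !(sbE sb) ram_pB !scalerA im2 /D; have -> : - 1 - (k - 1) = - k by lia.
  by congr (_ *: _); ring.
have qE : im *: q = C 0 by rewrite /C subr0 (rt_q rt).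
have bbD k : br (B 0) (br (B 0) (D k)) = (k%:~R + 2^-1) *: D k.
  rewrite /B oppr0 !(sbE sb) scalerA im2 ram_bbD scalerA; congr (_ *: _).
  by rewrite rmorphB rmorphN /=; field.
have bbB k : br (B 0) (br (B 0) (B k)) = k%:~R *: B k.
  rewrite {1 2}/B oppr0 !(sbE sb) scalerA im2 ram_bbB !scalerA; congr (_ *: _).
  by ring.
have X0 : br (D 0) (D (- 1)) = 0.
  by rewrite (sb_anti sb (ramD_hom _) (ramD_hom _)) // [br _ _]x0 oppr0.
have X1 : br (D 0) (D 1) = 0 by [].
have Y1 : br (B 1) (D 0) + C (1 + 0) = 0.
  by rewrite /B (sbE sb) y1 -scalerDr addNr scaler0.
have Y3 : br (B 1) (D 2) + C (1 + 2) = 0.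
  by rewrite /B (sbE sb) y3 -scalerDr addNr scaler0.
have hDD := tower_DD charF sb CE AE hB (fun k => ramD_hom _) hq' hp' qD qB pD pB qE
  bbD bbB X0 X1 Y1 Y3.
have hBD := tower_BD charF sb CE AE hB (fun k => ramD_hom _) hq' hp' qD qB pD pB qE
  bbD bbB X0 X1 Y1 Y3.
split=> i j h.
  have := hDD (- 1 - i) (- 1 - j) ltac:(lia).
  by rewrite /D !opprB !addrA ![_ + i]addrC ![_ + j]addrC !addrK.
have := hBD (- i) (- 1 - j) ltac:(lia).
rewrite /B /D !(sbE sb) opprK oppr0 => /(scalerI im0).
have -> : - 1 - (- 1 - j) = j by lia.
by have -> : - 1 - (- i + (- 1 - j)) = i + j by lia.
Qed.

End RamondFamilies.

(** * Basis and multiplication table of the Ramond algebra *)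

Section RamondAlgebra.
Variables (F : fieldType) (charF : [pchar F] =i pred0).
Local Notation K := (KA2 charF).
Local Notation L := (KRamond charF).

Let two_neq0 : 2%:R != 0 :> F.
Proof. by have := charF 2; rewrite !inE /= => ->. Qed.

Definition ridx (g : gmon) (n : int) : int * gmon := (2 * n + (g.2 : nat)%:Z, g).

Lemma ridx_ramond g n : (<< ridx g n >> : K) \in @ramond_pred F charF.
Proof.
apply/ramondP => k; rewrite mcoeffU; case: (_ =P k) => [<- _|_]; last first.
  by rewrite eqxx.
by rewrite /ramond_mon /=; case: g => [g1 []] /=; apply/eqP; lia.
Qed.

(* [rmon g n] is t ^ (2 n) g if xi_2 does not occur in g, t ^ (2 n + 1) g if it
   does. *)
Definition rmon (g : gmon) (n : int) : L := MkKRamond (ridx_ramond g n).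

Lemma rmon_homog g n : homog (gpar g) (rmon g n).
Proof. exact: khomogU. Qed.

Lemma rmon_br g h m n : lbr (rmon g m) (rmon h n) =
  kcoef F (ridx g m) (ridx h n)
    *: rmon (gxor g h) (m + n + (g.2 && h.2 : nat)%:Z).
Proof.
apply: val_inj; rewrite [LHS]kbrU; congr (_ *: << _ >>).
by rewrite /kadd /ridx; congr (_, _); case: g h => [g1 []] [h1 []] /=; lia.
Qed.

Lemma rmon_ind (P : L -> Prop) :
  (forall c x y, P x -> P y -> P (c *: x + y)) -> (forall g n, P (rmon g n)) ->
  forall y, P y.
Proof.
move=> Plin Pmon y.
have P0 : P 0.
  by rewrite -(addNr (rmon (false, false) 0)) -scaleN1r; apply: Plin.
suff [z e Pz] : exists2 z : L, kr_val z = kr_val y & P z.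
  by rewrite -(val_inj e).
apply: (@malg_ind_supp _ _ (fun u : kspace F => exists2 z : L, kr_val z = u & P z)).
- by exists 0.
- move=> c v w [zv ev Pv] [zw ew Pw]; exists (c *: zv + zw); last exact: Plin.
  by rewrite -ev -ew.
move=> [i [g1 g2]] /(ramondP _ (valP y)); rewrite /ramond_mon /= => /eqP e.
have ei : 2 * (i %/ 2)%Z + (g2 : nat)%:Z = i by case: g2 e => /=; lia.
by exists (rmon (g1, g2) (i %/ 2)%Z); rewrite //= /ridx ei.
Qed.

Local Notation rA := (rmon (false, false)).
Local Notation rB := (rmon (true, false)).
Local Notation rC := (rmon (false, true)).
Local Notation rD := (rmon (true, true)).

Let rbr g h m n k c : k = m + n + (g.2 && h.2 : nat)%:Z ->
  kcoef F (ridx g m) (ridx h n) = c ->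
  lbr (rmon g m) (rmon h n) = c *: rmon (gxor g h) k.
Proof. by move=> -> <-; apply: rmon_br. Qed.

Lemma rBA m n : lbr (rB m) (rA n) = (2 * m%:~R - n%:~R) *: rB (m + n).
Proof.
apply: (@rbr (true, false) (false, false)); first by rewrite ?addr0.
by rewrite /kcoef /gmul_sg /gbr_sg /gpar /gdeg /=; field.
Qed.
Lemma rBB m n : lbr (rB m) (rB n) = (- 1) *: rA (m + n).
Proof.
apply: (@rbr (true, false) (true, false)); first by rewrite ?addr0.
by rewrite /kcoef /gmul_sg /gbr_sg /gpar /gdeg /=; field.
Qed.
Lemma rBC m n : lbr (rB m) (rC n) = (m%:~R - n%:~R - 2^-1) *: rD (m + n).
Proof.
apply: (@rbr (true, false) (false, true)); first by rewrite ?addr0.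
by rewrite /kcoef /gmul_sg /gbr_sg /gpar /gdeg /=; field.
Qed.
Lemma rBD m n : lbr (rB m) (rD n) = (- 1) *: rC (m + n).
Proof.
apply: (@rbr (true, false) (true, true)); first by rewrite ?addr0.
by rewrite /kcoef /gmul_sg /gbr_sg /gpar /gdeg /=; field.
Qed.
Lemma rDA m n : lbr (rD m) (rA n) = (2 * m%:~R + 1) *: rD (m + n).
Proof.
apply: (@rbr (true, true) (false, false)); first by rewrite ?addr0.
by rewrite /kcoef /gmul_sg /gbr_sg /gpar /gdeg /=; field.
Qed.
Lemma rDB m n : lbr (rD m) (rB n) = (1) *: rC (m + n).
Proof.
apply: (@rbr (true, true) (true, false)); first by rewrite ?addr0.
by rewrite /kcoef /gmul_sg /gbr_sg /gpar /gdeg /=; field.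
Qed.
Lemma rDC m n : lbr (rD m) (rC n) = (- 1) *: rB (m + n + 1).
Proof.
apply: (@rbr (true, true) (false, true)); first by [].
by rewrite /kcoef /gmul_sg /gbr_sg /gpar /gdeg /=; field.
Qed.
(** The zero coefficient keeps the shape of the other entries, which [lifts_eq] relies on. *)
Lemma rDD m n : lbr (rD m) (rD n) = (0) *: rA (m + n + 1).
Proof.
apply: (@rbr (true, true) (true, true)); first by [].
by rewrite /kcoef /gmul_sg /gbr_sg /gpar /gdeg /=; field.
Qed.
Lemma rCB m n : lbr (rC m) (rB n) = (n%:~R - m%:~R - 2^-1) *: rD (m + n).
Proof.
apply: (@rbr (false, true) (true, false)); first by rewrite ?addr0.
by rewrite /kcoef /gmul_sg /gbr_sg /gpar /gdeg /=; field.
Qed.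
Lemma rCD m n : lbr (rC m) (rD n) = (1) *: rB (m + n + 1).
Proof.
apply: (@rbr (false, true) (true, true)); first by [].
by rewrite /kcoef /gmul_sg /gbr_sg /gpar /gdeg /=; field.
Qed.
Lemma rCC m n : lbr (rC m) (rC n) = (- 1) *: rA (m + n + 1).
Proof.
apply: (@rbr (false, true) (false, true)); first by [].
by rewrite /kcoef /gmul_sg /gbr_sg /gpar /gdeg /=; field.
Qed.
Lemma rAB m n : lbr (rA m) (rB n) = (m%:~R - 2 * n%:~R) *: rB (m + n).
Proof.
apply: (@rbr (false, false) (true, false)); first by rewrite ?addr0.
by rewrite /kcoef /gmul_sg /gbr_sg /gpar /gdeg /=; field.
Qed.
Lemma rAC m n : lbr (rA m) (rC n) = (m%:~R - 2 * n%:~R - 1) *: rC (m + n).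
Proof.
apply: (@rbr (false, false) (false, true)); first by rewrite ?addr0.
by rewrite /kcoef /gmul_sg /gbr_sg /gpar /gdeg /=; field.
Qed.
Lemma rAD m n : lbr (rA m) (rD n) = (- (2 * n%:~R + 1)) *: rD (m + n).
Proof.
apply: (@rbr (false, false) (true, true)); first by rewrite ?addr0.
by rewrite /kcoef /gmul_sg /gbr_sg /gpar /gdeg /=; field.
Qed.

(** * Generation by xi_1, t xi_1 xi_2 and t^-1 xi_1 xi_2 *)

Section Generation.
Variable P : bool -> L -> Prop.
Hypothesis PZ : forall p (c : F) x, P p x -> P p (c *: x).
Hypothesis Pbr : forall p q x y, P p x -> P q y -> P (p (+) q) (lbr x y).
Hypotheses (Pb : P true (rB 0)) (Pd : P false (rD 0)) (Pe : P false (rD (- 1))).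

Let Pstep p q x y c z : P p x -> P q y -> lbr x y = c *: z -> 2 * c != 0 ->
  P (p (+) q) z.
Proof.
move=> hx hy e c0; have {}c0 : c != 0.
  by apply: contraNneq c0 => ->; rewrite mulr0.
by rewrite -[z](scalerK c0) -e; apply/PZ/Pbr.
Qed.

Let neq0 (k : int) c : 2 * c = k%:~R -> k != 0 -> 2 * c != 0 :> F.
Proof. by move=> ->; apply: intr_neq0. Qed.

(** Every basis vector is a nonzero multiple of one bracket of earlier ones, so [P] may be a graded
    property not closed under sums. Climb with t xi_2, descend with t^-1 xi_2, then bracket with
    xi_1. *)
Lemma rmon_generated g n : P (gpar g) (rmon g n).
Proof.
have PC k : P false (rD k) -> P true (rC k).
  have := rBD 0 k; rewrite add0r => E h; apply: (Pstep Pb h E).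
  by apply: (@neq0 (- 2)) => //; ring.
have PA k : P true (rB k) -> P false (rA k).
  have := rBB 0 k; rewrite add0r => E h; apply: (Pstep Pb h E).
  by apply: (@neq0 (- 2)) => //; ring.
have Pp := PC 0 Pd; have Pq := PC _ Pe.
have up (k : nat) : P true (rB k) /\ P false (rD k).
  elim: k => // k [_ h].
  have hB : P true (rB k.+1).
    have := rCD 0 k; have -> : 0 + k%:Z + 1 = k.+1 by lia.
    move=> E; apply: (Pstep Pp h E).
    by apply: (@neq0 2) => //; ring.
  split=> //; have := rCB 0 k.+1; rewrite add0r => E.
  apply: (Pstep Pp hB E).
  by apply: (@neq0 (2 * k.+1%:Z - 1)); [field | lia].
have down (k : nat) : P true (rB (- k%:Z)) /\ P false (rD (- 1 - k%:Z)).
  elim: k => [|k [_ h]]; first by rewrite oppr0 subr0.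
  have hB : P true (rB (- k.+1%:Z)).
    have := rCD (- 1) (- 1 - k%:Z).
    have -> : - 1 + (- 1 - k%:Z) + 1 = - k.+1%:Z by lia.
    move=> E; apply: (Pstep Pq h E).
    by apply: (@neq0 2) => //; ring.
  split=> //.
  apply: (Pstep Pq hB (rCB (- 1) (- k.+1%:Z))).
  by apply: (@neq0 (1 - 2 * k.+1%:Z)); [field | lia].
have PB (k : int) : P true (rB k).
  case: k => k; first by have [] := up k.
  by have [h _] := down k.+1; rewrite NegzE.
have PD (k : int) : P false (rD k).
  case: k => k; first by have [] := up k.
  by have [_ h] := down k; have -> : Negz k = - 1 - k%:Z by lia.
by case: g => [[] []]; [exact: PD | exact: PB | exact: PC | exact: PA].
Qed.

End Generation.

(** * The homomorphism out of [L] defined by the four families *)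

Section Model.
Variables (V : lmodType F) (br : V -> V -> V) (hom : bool -> V -> Prop).
Variables (sb : super_bracket br hom) (b d e p q : V).
Hypothesis rt : ramond_triple br hom b d e p q.

Local Notation B := (ramB br b d e p q).
Local Notation D := (ramD br b d e p q).
Local Notation C := (ramC br b d e p q).
Local Notation A := (ramA br b d e p q).

Hypothesis dD : forall k, br d (D k) = 0.
Hypothesis eD : forall k, br e (D k) = 0.
Hypothesis Bd : forall k, br (B k) d = br b (D k).
Hypothesis Be : forall k, br (B k) e = br b (D (k - 1)).

Definition rfam (g : gmon) (k : int) : V :=
  match g with
  | (false, false) => A k | (true, false) => B k
  | (false, true) => C k | (true, true) => D k
  end.

Definition rmodel (y : L) : V :=
  lext (fun k : int * gmon => rfam k.2 (k.1 %/ 2)%Z) (kr_val y).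

Lemma rmodel_linear : linear rmodel.
Proof. by move=> c x y; apply: lext_linear. Qed.
Let rmodelD x y : rmodel (x + y) = rmodel x + rmodel y.
Proof. by have := rmodel_linear 1 x y; rewrite !scale1r. Qed.
Let rmodel0 : rmodel 0 = 0.
Proof. by apply: (addIr (rmodel 0)); rewrite -rmodelD !add0r. Qed.
Let rmodelZ c x : rmodel (c *: x) = c *: rmodel x.
Proof. by have := rmodel_linear c x 0; rewrite !addr0 rmodel0 addr0. Qed.

Lemma rmodelU g n : rmodel (rmon g n) = rfam g n.
Proof.
rewrite /rmodel lextU /=; congr rfam.
by case: g.2 => /=; lia.
Qed.

Let hb := rt_hb rt.

Lemma rmodel_homog g n : hom (gpar g) (rfam g n).
Proof.
have hB k : hom true (B k) := ramB_hom sb rt k.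
have hD k : hom false (D k) := ramD_hom sb rt k.
case: g => [[] []]; rewrite /= ?[gpar _]/= //.
  exact: (sb_hN sb (sb_hom sb hb (hD n))).
exact: (sb_hN sb (sb_hom sb hb (hB n))).
Qed.

Let Db k : br d (B k) = C k.
Proof. by rewrite (sb_anti sb (rt_hd rt) (ramB_hom sb rt k)) // Bd. Qed.
Let Eb k : br e (B k) = C (k - 1).
Proof. by rewrite (sb_anti sb (rt_he rt) (ramB_hom sb rt k)) // Be. Qed.
Let hp : hom true p.
Proof. by rewrite (rt_p rt); exact: (sb_hN sb (sb_hom sb hb (rt_hd rt))). Qed.
Let hq : hom true q.
Proof. by rewrite (rt_q rt); exact: (sb_hN sb (sb_hom sb hb (rt_he rt))). Qed.
(** Reduces the action of d on [C] and [A] to its action on [D] and [B], which the hypotheses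
    give. *)
Let db x : br d (br b x) = br p x + br b (br d x).
Proof.
rewrite (sb_jac sb _ (rt_hd rt) hb) // (sb_anti sb (rt_hd rt) hb) //.
by rewrite (rt_p rt).
Qed.
Let eb x : br e (br b x) = br q x + br b (br e x).
Proof.
rewrite (sb_jac sb _ (rt_he rt) hb) // (sb_anti sb (rt_he rt) hb) //.
by rewrite (rt_q rt).
Qed.
Let bC k : br b (C k) = - ((k%:~R + 2^-1) *: D k).
Proof. by rewrite (sbE sb) (ram_bbD charF sb rt). Qed.

Lemma rmodel_b g n : rmodel (lbr (rB 0) (rmon g n)) = br b (rfam g n).
Proof.
case: g => [[] []]; [rewrite rBD|rewrite rBB|rewrite rBC|rewrite rBA];
  rewrite rmodelZ rmodelU /= [0 + n]add0r.
- by rewrite scaleN1r opprK.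
- by rewrite scaleN1r opprK.
- by rewrite bC; lmod_coefs F; ring.
- by rewrite (sbE sb) (ram_bbB charF sb rt); lmod_coefs F; ring.
Qed.

Lemma rmodel_d g n : rmodel (lbr (rD 0) (rmon g n)) = br d (rfam g n).
Proof.
case: g => [[] []]; [rewrite rDD|rewrite rDB|rewrite rDC|rewrite rDA];
  rewrite rmodelZ rmodelU /= [0 + n]add0r.
- by rewrite scale0r dD.
- by rewrite scale1r Db.
- by rewrite scaleN1r (sbE sb) db dD (sbE sb) addr0 (ram_pD charF sb rt).
- rewrite (sbE sb) db Db bC (ram_pB charF sb rt).
  by lmod_coefs F; field.
Qed.

Lemma rmodel_e g n : rmodel (lbr (rD (- 1)) (rmon g n)) = br e (rfam g n).
Proof.
have E : - 1 + n = n - 1 by rewrite addrC.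
case: g => [[] []]; [rewrite rDD|rewrite rDB|rewrite rDC|rewrite rDA];
  rewrite rmodelZ rmodelU /= E ?subrK.
- by rewrite scale0r eD.
- by rewrite scale1r Eb.
- by rewrite scaleN1r (sbE sb) eb eD (sbE sb) addr0 (ram_qD charF sb rt).
- rewrite (sbE sb) eb Eb bC (ram_qB charF sb rt).
  by lmod_coefs F; field.
Qed.

(** By the Jacobi identity on both sides, the homogeneous x whose adjoint action is intertwined by
    [rmodel] are closed under brackets. By [rmon_generated] it is enough to check b, d and e. *)
Lemma rmodel_br x y : rmodel (lbr x y) = br (rmodel x) (rmodel y).
Proof.
have sbL := lie_super_bracket L.
have lin z : (forall g n, rmodel (lbr z (rmon g n)) = br (rmodel z) (rfam g n)) ->
    forall y, rmodel (lbr z y) = br (rmodel z) (rmodel y).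
  move=> h; apply: rmon_ind => [c u v hu hv|g n]; last by rewrite rmodelU.
  by rewrite (sb_linr sbL) !rmodel_linear (sb_linr sb) hu hv.
pose P r (x : L) := [/\ homog r x, hom r (rmodel x) &
  forall y, rmodel (lbr x y) = br (rmodel x) (rmodel y)].
suff P' g n : P (gpar g) (rmon g n).
  elim/rmon_ind: x => [c u v hu hv|g n]; last by case: (P' g n).
  by rewrite (sb_linl sbL) !rmodel_linear (sb_linl sb) hu hv.
have Pmon g' n' : (forall g n,
    rmodel (lbr (rmon g' n') (rmon g n)) = br (rfam g' n') (rfam g n)) ->
    P (gpar g') (rmon g' n').
  move=> h; split; [exact: rmon_homog|by rewrite rmodelU; apply: rmodel_homog|].
  by apply: lin => g1 n1; rewrite h rmodelU.
apply: rmon_generated.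
- move=> r c u [h1 h2 h3]; split; first exact: (sb_hZ sbL).
    by rewrite rmodelZ; apply: (sb_hZ sb).
  by move=> v; rewrite (sbZl sbL) !rmodelZ h3 (sbZl sb).
- move=> r r' u v [hu hu' mu] [hv hv' mv]; split; first exact: homog_lbr.
    by rewrite mu; apply: (sb_hom sb).
  move=> w; have := congr1 rmodel (lbr_jacobi _ _ _ _ w hu hv).
  rewrite rmodelD rmodelZ (mu (lbr v w)) (mv w) (mv (lbr u w)) (mu w) (mu v).
  by rewrite (sb_jacobi sb _ hu' hv') => /addIr.
- by apply: (Pmon (true, false)); apply: rmodel_b.
- by apply: (Pmon (true, true)); apply: rmodel_d.
- by apply: (Pmon (true, true)); apply: rmodel_e.
Qed.

End Model.

End RamondAlgebra.

(** * Induction on free Lie superalgebras, and elements of bounded degree *)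

Section FreeInduction.
Variables (F : fieldType) (X : Type) (par : X -> bool).
Local Notation L := (freeLS F par).

Lemma freeLS_ind (P : L -> Prop) :
  P 0 -> (forall c x y, P x -> P y -> P (c *: x + y)) ->
  (forall x y, P x -> P y -> P (lbr x y)) -> (forall j, P (fgen F par j)) ->
  forall u, P u.
Proof.
move=> P0 Plin Pbr Pgen u; rewrite -[u]reprK.
have piE a b : teq par a b -> \pi_L a = \pi_L b.
  by move=> h; apply/eqmodP/asboolP.
have reprT a : teq par (repr (\pi_L a)) a.
  have : \pi_L (repr (\pi_L a)) = \pi_L a by rewrite reprK.
  by move/eqmodP/asboolP.
have PZ c x : P x -> P (c *: x) by move=> h; rewrite -[_ *: _]addr0; apply: Plin.
elim: (repr u) => [j||a iha b ihb|s a iha|a iha b ihb].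
- exact: Pgen.
- exact: P0.
- rewrite -[X in P X](piE _ _ (teq_add (reprT a) (reprT b))).
  by have := Plin 1 _ _ iha ihb; rewrite scale1r.
- by rewrite -[X in P X](piE _ _ (teq_scale s (reprT a))); apply: (PZ s).
- by rewrite -[X in P X](piE _ _ (teq_br (reprT a) (reprT b))); apply: Pbr iha ihb.
Qed.

End FreeInduction.

Section Degree.
Variables (F : fieldType) (L : lieSuperType F) (X : Type) (x : X -> L).

Lemma degree_le_lin n (c : F) u v :
  degree_le x n u -> degree_le x n v -> degree_le x n (c *: u + v).
Proof.
move=> [m [a [w [hw ->]]]] [m' [a' [w' [hw' ->]]]].
exists (m + m')%N, (fun i => match split i with inl j => c * a j | inr j => a' j end),
  (fun i => match split i with inl j => w j | inr j => w' j end); split.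
  by move=> i; case: (split i).
rewrite big_split_ord scaler_sumr /=; congr (_ + _); apply: eq_bigr => i _.
  by rewrite (unsplitK (inl i)) scalerA.
by rewrite (unsplitK (inr i)).
Qed.

Lemma degree_le_ind n (P : L -> Prop) :
  P 0 -> (forall c u v, P u -> P v -> P (c *: u + v)) ->
  (forall k u, (k <= n)%N -> commutator x k u -> P u) ->
  forall u, degree_le x n u -> P u.
Proof.
move=> P0 Plin Pc u [m [a [w [hw ->]]]]; elim/big_ind: _ => //.
  by move=> y z hy hz; rewrite -[y]scale1r; apply: Plin.
move=> i _; rewrite -[_ *: _]addr0; apply: Plin => //.
by have [k hk] := hw i; apply: Pc.
Qed.

Lemma degree_le0 n : degree_le x n 0.
Proof.
exists 0%N, (fun=> 0), (fun=> 0); split; first by case.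
by rewrite big_ord0.
Qed.

Lemma degree_le_commutator n k u :
  (k <= n)%N -> commutator x k u -> degree_le x n u.
Proof.
move=> hk hu; exists 1%N, (fun=> 1), (fun=> u); split; first by exists k.
by rewrite big_ord_recl big_ord0 scale1r addr0.
Qed.

Lemma degree_le_lbr m n u v :
  degree_le x m u -> degree_le x n v -> degree_le x (m + n) (lbr u v).
Proof.
have sb := lie_super_bracket L; move=> hu hv; move: u hu; apply: degree_le_ind.
- by rewrite (sb0l sb); apply: degree_le0.
- by move=> c u u' h h'; rewrite (sb_linl sb); apply: degree_le_lin.
move=> k u hk hu; move: v hv; apply: degree_le_ind.
- by rewrite (sb0r sb); apply: degree_le0.
- by move=> c v v' h h'; rewrite (sb_linr sb); apply: degree_le_lin.
move=> l v hl hv; apply: (@degree_le_commutator _ (k + l)); first exact: leq_add.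
exact: commutator_lbr.
Qed.

Lemma degree_le_mono m n u : (m <= n)%N -> degree_le x m u -> degree_le x n u.
Proof.
move=> mn [k [c [w [hw ->]]]]; exists k, c, w; split=> // i.
by have [l hl] := hw i; exists l => //; apply: leq_trans mn.
Qed.

End Degree.

(** * The quotient by an ideal *)

Section IdealQuotient.
Variables (F : fieldType) (L : lieSuperType F) (I : L -> Prop) (idI : ls_ideal I).

Definition ideal_mem : {pred L} := [pred x | `[< I x >]].

Lemma ideal_mem_zmod : zmod_closed ideal_mem.
Proof.
have [I0 IL _ _] := idI; split=> [|x y /asboolP hx /asboolP hy].
  exact/asboolP.
by apply/asboolP; rewrite addrC -scaleN1r; apply: IL.
Qed.
HB.instance Definition _ := GRing.isZmodClosed.Build L ideal_mem ideal_mem_zmod.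

Definition ideal_quot := Quotient.quot ideal_mem.

HB.instance Definition _ := GRing.Zmodule.on ideal_quot.
HB.instance Definition _ := Quotient.on ideal_quot.

Local Notation Q := ideal_quot.
Local Notation pi := (\pi_Q).

Let piP (x y : L) : pi x = pi y <-> I (x - y).
Proof.
split=> [/eqP|h].
  by rewrite -Quotient.idealrBE => /asboolP.
by apply/eqP; rewrite -Quotient.idealrBE; apply/asboolP.
Qed.

Let IZ c x : I x -> I (c *: x).
Proof.
by case: idI => I0 IL _ _ h; rewrite -[_ *: _]addr0; apply: IL.
Qed.
Let ID x y : I x -> I y -> I (x + y).
Proof. by case: idI => _ IL _ _ hx hy; rewrite -[x]scale1r; apply: IL. Qed.

Let piD x y : pi (x + y) = pi x + pi y.
Proof. by rewrite raddfD. Qed.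

Let qind (P : Q -> Prop) : (forall x, P (pi x)) -> forall u, P u.
Proof. by move=> h u; rewrite -[u]reprK. Qed.

Let reprI x : I (repr (pi x) - x).
Proof. by apply/piP; rewrite reprK. Qed.

Let qscale (c : F) (u : Q) : Q := pi (c *: repr u).
Let qscaleE c x : qscale c (pi x) = pi (c *: x).
Proof. by apply/piP; rewrite -scalerBr; apply/IZ/reprI. Qed.

Let qscaleA c c' u : qscale c (qscale c' u) = qscale (c * c') u.
Proof. by elim/qind: u => x; rewrite !qscaleE scalerA. Qed.
Let qscale1 : left_id 1 qscale.
Proof. by elim/qind=> x; rewrite qscaleE scale1r. Qed.
Let qscaleDr : right_distributive qscale +%R.
Proof.
move=> c; elim/qind=> x; elim/qind=> y.
by rewrite !qscaleE -!piD qscaleE scalerDr.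
Qed.
Let qscaleDl u : {morph qscale^~ u : c c' / c + c'}.
Proof. by move=> c c'; elim/qind: u => x; rewrite !qscaleE -piD scalerDl. Qed.
HB.instance Definition _ :=
  GRing.Zmodule_isLmodule.Build F Q qscaleA qscale1 qscaleDr qscaleDl.

Let sbL := lie_super_bracket L.

Definition quot_br (u v : Q) : Q := pi (lbr (repr u) (repr v)).
Definition quot_hom r (u : Q) := exists2 x, homog r x & u = pi x.

Lemma quot_piZ (c : F) x y : pi (c *: x + y) = c *: pi x + pi y.
Proof. by rewrite piD -[pi (c *: x)]qscaleE. Qed.

Lemma quot_pi_lbr x y : pi (lbr x y) = quot_br (pi x) (pi y).
Proof.
have [_ _ Ir Il] := idI; apply/esym/piP.
have -> : lbr (repr (pi x)) (repr (pi y)) - lbr x y =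
    lbr (repr (pi x) - x) (repr (pi y)) + lbr x (repr (pi y) - y).
  by rewrite (sbDl sbL) (sbDr sbL) (sbNl sbL) (sbNr sbL) addrA subrK.
by apply: ID; [apply: Il | apply: Ir]; apply: reprI.
Qed.

Lemma quot_pi_eq0 x : pi x = 0 <-> I x.
Proof.
have -> : (0 : Q) = pi 0 by rewrite raddf0.
by rewrite piP subr0.
Qed.

Lemma quot_super_bracket : super_bracket quot_br quot_hom.
Proof.
have Z c (x : L) : pi (c *: x) = c *: pi x.
  by rewrite -[X in pi X]addr0 quot_piZ raddf0 addr0.
split.
- move=> r c u v [x hx ->] [y hy ->]; exists (c *: x + y); first exact: homog_lin.
  by rewrite quot_piZ.
- move=> c; elim/qind=> x; elim/qind=> y; elim/qind=> z.
  by rewrite -quot_piZ -!quot_pi_lbr -quot_piZ (sb_linl sbL).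
- move=> c; elim/qind=> x; elim/qind=> y; elim/qind=> z.
  by rewrite -quot_piZ -!quot_pi_lbr -quot_piZ (sb_linr sbL).
- move=> r r' u v [x hx ->] [y hy ->]; exists (lbr x y); first exact: homog_lbr.
  exact/esym/quot_pi_lbr.
- move=> r r' u v [x hx ->] [y hy ->].
  by rewrite -!quot_pi_lbr -Z -raddfN (lbr_skew _ _ _ _ hx hy).
- move=> r r' u v w [x hx ->] [y hy ->]; elim/qind: w => z.
  by rewrite -!quot_pi_lbr -Z -piD -(lbr_jacobi _ _ _ _ _ hx hy).
Qed.

End IdealQuotient.

(** * The Ramond algebra from its relations of degree at most 5 *)

Section Presentation.
Variables (F : fieldType) (charF : [pchar F] =i pred0).
Local Notation L := (KRamond charF).
Local Notation FL := (freeLS F gen_par).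
Hypothesis sqrtN1 : exists i : F, i * i = - 1.
Variables (phi : {linear FL -> L}) (phiM : ls_morphism phi).
Hypothesis phi_gen : forall j, phi (fgen F gen_par j) = ramond_gen charF j.

Local Notation rA := (rmon charF (false, false)).
Local Notation rB := (rmon charF (true, false)).
Local Notation rC := (rmon charF (false, true)).
Local Notation rD := (rmon charF (true, true)).
Local Notation gen k := (@Ordinal 8 k isT).

Let two_neq0 : 2%:R != 0 :> F.
Proof. by have := charF 2; rewrite !inE /= => ->. Qed.

Lemma ramond_genE : [/\ ramond_gen charF (gen 0) = rA 1,
   ramond_gen charF (gen 1) = rA (- 1), ramond_gen charF (gen 2) = rA 2 &
   ramond_gen charF (gen 3) = rA (- 2)] /\
  [/\ ramond_gen charF (gen 4) = rB 0, ramond_gen charF (gen 5) = rC 0,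
   ramond_gen charF (gen 6) = rD 0 & ramond_gen charF (gen 7) = rD (- 1)].
Proof. by split; split; apply: val_inj. Qed.

Lemma ramond_surj y : exists u, phi u = y.
Proof.
have [mor _] := phiM; have [_ [g4 _ g6 g7]] := ramond_genE.
elim/rmon_ind: y => [c _ _ [u <-] [v <-]|g n].
  by exists (c *: u + v); rewrite linearP.
apply: (@rmon_generated _ charF (fun _ y => exists u, phi u = y)).
- by move=> _ c _ [u <-]; exists (c *: u); rewrite linearZ.
- by move=> _ _ _ _ [u <-] [v <-]; exists (lbr u v); rewrite mor.
- by exists (fgen F gen_par (gen 4)); rewrite phi_gen.
- by exists (fgen F gen_par (gen 6)); rewrite phi_gen.
- by exists (fgen F gen_par (gen 7)); rewrite phi_gen.
Qed.

Lemma ramond_ker_ideal : ls_ideal (fun u => phi u = 0).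
Proof.
have sbL := lie_super_bracket L; have [mor _] := phiM.
split=> [|c x y hx hy|x y hy|x y hx]; first exact: linear0.
- by rewrite linearP /= hx hy scaler0 addr0.
- by rewrite mor hy (sb0r sbL).
- by rewrite mor hx (sb0l sbL).
Qed.

Section Quotient.
Variables (I : FL -> Prop) (idI : ls_ideal I).
Hypothesis I5 : forall v, phi v = 0 -> degree_le (fgen F gen_par) 5 v -> I v.

Local Notation V := (ideal_quot idI).
Local Notation pi := (\pi_V).
Local Notation br := (@quot_br _ _ _ idI).
Local Notation hom := (@quot_hom _ _ _ idI).
Let sb : super_bracket br hom := quot_super_bracket idI.

(* y is the image of an element of degree at most n lying over x; for n = 5 it
   is determined by x. *)
Definition lifts n (x : L) (y : V) := exists u : FL,
  [/\ degree_le (fgen F gen_par) n u, phi u = x & pi u = y].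

Lemma lifts_uniq m n x y y' :
  lifts m x y -> lifts n x y' -> (m <= 5)%N -> (n <= 5)%N -> y = y'.
Proof.
move=> [u [hu pu <-]] [v [hv pv <-]] m5 n5.
suff h : pi (- 1 *: v + u) = 0.
  by apply/eqP; rewrite -subr_eq0 -[pi v]scale1r -scaleNr addrC -quot_piZ h.
apply/quot_pi_eq0/I5; first by rewrite linearP /= pu pv scaleN1r addNr.
by apply: degree_le_lin; [apply: degree_le_mono hv|apply: degree_le_mono hu].
Qed.

Lemma lifts_lbr m n x x' y y' :
  lifts m x y -> lifts n x' y' -> lifts (m + n) (lbr x x') (br y y').
Proof.
have [mor _] := phiM; move=> [u [hu <- <-]] [v [hv <- <-]]; exists (lbr u v).
by split; [exact: degree_le_lbr | exact: mor | exact: quot_pi_lbr].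
Qed.

Lemma liftsZ n (c : F) x y : lifts n x y -> lifts n (c *: x) (c *: y).
Proof.
move=> [u [hu <- <-]]; exists (c *: u); split; last 1 first.
- by rewrite -[c *: u]addr0 quot_piZ raddf0 addr0.
- by rewrite -[c *: u]addr0; apply: degree_le_lin => //; apply: degree_le0.
- by rewrite linearZ.
Qed.

(** Transports an entry of the multiplication table of [L] to the quotient, as long as both sides
    have degree at most 5. *)
Lemma lifts_eq k m n x x' y y' z w c c' :
  lifts m x y -> lifts n x' y' -> lifts k z w -> lbr x x' = c *: z ->
  c = c' -> (m + n <= 5)%N -> (k <= 5)%N -> br y y' = c' *: w.
Proof.
move=> h h' hw e <- mn5 k5.
have := lifts_lbr h h'; rewrite e => hl.
exact: (lifts_uniq hl (liftsZ c hw)).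
Qed.

(** When a bracket is known on both sides with the same nonzero coefficient, it provides a lift of
    its value, here with no bound on the degree. *)
Lemma lifts_new m n x x' y y' z w c c' :
  lifts m x y -> lifts n x' y' -> lbr x x' = c *: z -> br y y' = c' *: w ->
  c = c' -> 2 * c != 0 -> lifts (m + n) z w.
Proof.
move=> h h' e e' ec c0; subst c'; have {}c0 : c != 0.
  by apply: contraNneq c0 => ->; rewrite mulr0.
have := liftsZ c^-1 (lifts_lbr h h').
by rewrite e e' !scalerK.
Qed.


(** Replaces a long lift by a shorter one. Brackets with the generators t^2, t^-2, t^4, t^-4 are
    what keeps the degrees within 5. *)
Lemma lifts_short k m n x x' y y' z w c :
  lifts k z w -> lifts m x y -> lifts n x' y' -> lbr x x' = c *: z ->
  2 * c != 0 -> (m + n <= 5)%N -> (k <= 5)%N -> lifts (m + n) z w.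
Proof.
move=> hw h h' e c0 mn5 k5.
exact: (lifts_new h h' e (lifts_eq h h' hw e erefl mn5 k5) erefl c0).
Qed.

Let lifts_gen j : lifts 1 (ramond_gen charF j) (pi (fgen F gen_par j)).
Proof.
exists (fgen F gen_par j); split=> //.
by apply: (@degree_le_commutator _ _ _ _ 1 1) => //; constructor.
Qed.

Let b : V := pi (fgen F gen_par (gen 4)).
Let d : V := pi (fgen F gen_par (gen 6)).
Let e : V := pi (fgen F gen_par (gen 7)).
Let p : V := - br b d.
Let q : V := - br b e.

Local Notation B := (ramB br b d e p q).
Local Notation D := (ramD br b d e p q).
Local Notation C := (ramC br b d e p q).
Local Notation A := (ramA br b d e p q).

Lemma lifts_gens : [/\ lifts 1 (rB 0) b, lifts 1 (rD 0) d,
    lifts 1 (rD (- 1)) e & lifts 1 (rC 0) (pi (fgen F gen_par (gen 5)))] /\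
  [/\ lifts 1 (rA 1) (pi (fgen F gen_par (gen 0))),
    lifts 1 (rA (- 1)) (pi (fgen F gen_par (gen 1))),
    lifts 1 (rA 2) (pi (fgen F gen_par (gen 2))) &
    lifts 1 (rA (- 2)) (pi (fgen F gen_par (gen 3)))].
Proof.
have [[e0 e1 e2 e3] [e4 e5 e6 e7]] := ramond_genE.
by split; split; rewrite -?e0 -?e1 -?e2 -?e3 -?e4 -?e5 -?e6 -?e7; apply: lifts_gen.
Qed.

Let neq0 (k : int) (c : F) : 2 * c = k%:~R -> k != 0 -> 2 * c != 0.
Proof. by move=> ->; apply: intr_neq0. Qed.

Let N1 (x : V) : - x = - 1 *: x. Proof. by rewrite scaleN1r. Qed.

Lemma quot_ramond_triple : ramond_triple br hom b d e p q.
Proof.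
have [[hb hd he hc] _] := lifts_gens.
have hp : lifts 2 (rC 0) p.
  apply: (lifts_new hb hd (rBD _ 0 0) (_ : _ = - 1 *: p)) => //.
    by rewrite scaleN1r opprK.
  by apply: (@neq0 (- 2)); [ring|].
(* As t xi_2 is itself a generator, p has a lift of degree 1, whereas q only gets one of degree
   2. *)
have pE := lifts_uniq hp hc isT isT; rewrite -pE in hc.
have hq : lifts 2 (rC (- 1)) q.
  apply: (lifts_new hb he (rBD _ 0 (- 1)) (_ : _ = - 1 *: q)) => //.
    by rewrite scaleN1r opprK.
  by apply: (@neq0 (- 2)); [ring|].
(* The unit lifts to [- br p q], whence the uses of [oppr_inj] below. Its degree 3 makes the
   relation for [br (br p q) q] one of degree exactly 5. *)
have hh : lifts 3 (rA 0) (- br p q).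
  apply: (lifts_new hc hq (rCC _ 0 (- 1)) (_ : _ = - 1 *: - br p q)) => //.
    by rewrite scaleN1r opprK.
  by apply: (@neq0 (- 2)); [ring|].
have homg j : hom (gen_par j) (pi (fgen F gen_par j)).
  by exists (fgen F gen_par j) => //; apply: fgen_homog.
split=> //; [exact: (homg (gen 4))|exact: (homg (gen 6))|exact: (homg (gen 7))|..].
- rewrite (lifts_eq hb hb hh (rBB _ 0 0) (erefl _)) //.
  by rewrite scaleN1r opprK.
- by rewrite (lifts_eq hc hb hd (rCB _ 0 0) (erefl _)) //; congr (_ *: _); ring.
- by rewrite (lifts_eq hq hb he (rCB _ (- 1) 0) (erefl _)) //; congr (_ *: _); field.
- by rewrite (lifts_eq hq hd hb (rCD _ (- 1) 0) (erefl _)) // scale1r.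
- by rewrite (lifts_eq hc he hb (rCD _ 0 (- 1)) (erefl _)) // scale1r.
- apply: oppr_inj; rewrite -(sbNl sb) (lifts_eq hh hc hc (rAC _ 0 0) (erefl _)) //.
  by rewrite N1; congr (_ *: _); ring.
- apply: oppr_inj; rewrite -(sbNl sb) (lifts_eq hh hq hq (rAC _ 0 (- 1)) (erefl _)) //.
  by rewrite opprK -[RHS]scale1r; congr (_ *: _); ring.
- apply: oppr_inj; rewrite -(sbNl sb) (lifts_eq hh hb hb (rAB _ 0 0) (erefl _)) //.
  by rewrite oppr0 -[RHS](scale0r b); congr (_ *: _); ring.
- apply: oppr_inj; rewrite -(sbNl sb) (lifts_eq hh hd hd (rAD _ 0 0) (erefl _)) //.
  by rewrite N1; congr (_ *: _); ring.
- apply: oppr_inj; rewrite -(sbNl sb) (lifts_eq hh he he (rAD _ 0 (- 1)) (erefl _)) //.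
  by rewrite opprK -[RHS]scale1r; congr (_ *: _); ring.
Qed.

Let rt := quot_ramond_triple.
Let pD k : br p (D k) = 1 *: B (k + 1).
Proof. by rewrite scale1r (ram_pD charF sb rt). Qed.
Let qD k : br q (D k) = 1 *: B k.
Proof. by rewrite scale1r (ram_qD charF sb rt). Qed.
Let bD k : br b (D k) = - 1 *: C k. Proof. by rewrite scaleN1r opprK. Qed.
Let bB k : br b (B k) = - 1 *: A k. Proof. by rewrite scaleN1r opprK. Qed.

Lemma quot_flat : [/\ forall k, br d (D k) = 0, forall k, br e (D k) = 0,
    forall k, br (B k) d = br b (D k) & forall k, br (B k) e = br b (D (k - 1))] /\
  [/\ pi (fgen F gen_par (gen 0)) = A 1, pi (fgen F gen_par (gen 1)) = A (- 1),
    pi (fgen F gen_par (gen 2)) = A 2, pi (fgen F gen_par (gen 3)) = A (- 2) &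
    pi (fgen F gen_par (gen 5)) = C 0].
Proof.
have [[hb hd he hc] [a1 m1 a2 m2]] := lifts_gens.
have one0 : 2 * 1 != 0 :> F by apply: (@neq0 2); [ring|].
have mone0 : 2 * - 1 != 0 :> F by apply: (@neq0 (- 2)); [ring|].
have hC0 : lifts 2 (rC 0) (C 0).
  exact: (lifts_new hb hd (rBD _ 0 0) (bD 0) erefl mone0).
have c0E : pi (fgen F gen_par (gen 5)) = C 0 := lifts_uniq hc hC0 isT isT.
rewrite c0E in hc.
have hq : lifts 2 (rC (- 1)) q.
  exact: (lifts_new hb he (rBD _ 0 (- 1)) (bD (- 1)) erefl mone0).
have h0 : lifts 2 (rA 0) (A 0).
  exact: (lifts_new hb hb (rBB _ 0 0) (bB 0) erefl mone0).
have B1 : lifts 2 (rB 1) (B 1).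
  exact: (lifts_new hc hd (rCD _ 0 0) (pD 0) erefl one0).
have D1 : lifts 2 (rD 1) (D 1).
  have h : lifts 3 (rD 1) (D 1).
    apply: (lifts_new hc B1 (rCB _ 0 1) (ram_pB charF sb rt 1)); first by ring.
    by apply: (@neq0 1); [field|].
  by apply: (lifts_short h a1 hd (rAD _ 1 0)) => //; apply: (@neq0 (- 2)); [ring|].
have B2 : lifts 3 (rB 2) (B 2).
  exact: (lifts_new hc D1 (rCD _ 0 1) (pD 1) erefl one0).
have D2 : lifts 2 (rD 2) (D 2).
  have h : lifts 4 (rD 2) (D 2).
    apply: (lifts_new hc B2 (rCB _ 0 2) (ram_pB charF sb rt 2)); first by ring.
    by apply: (@neq0 3); [field|].
  by apply: (lifts_short h a2 hd (rAD _ 2 0)) => //; apply: (@neq0 (- 2)); [ring|].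
have B3 : lifts 3 (rB 3) (B 3).
  exact: (lifts_new hc D2 (rCD _ 0 2) (pD 2) erefl one0).
have D3 : lifts 4 (rD 3) (D 3).
  apply: (lifts_new hc B3 (rCB _ 0 3) (ram_pB charF sb rt 3)); first by ring.
  by apply: (@neq0 5); [field|].
have C1 : lifts 3 (rC 1) (C 1).
  exact: (lifts_new hb D1 (rBD _ 0 1) (bD 1) erefl mone0).
(* Degree 5 is just enough to compare it with the bracket of [B 1] and [D 2] in [y3]. *)
have C3 : lifts 5 (rC 3) (C 3).
  exact: (lifts_new hb D3 (rBD _ 0 3) (bD 3) erefl mone0).
(* Going down, the recursion uses q, of degree 2 instead of 1, so each new [B] and [D] is shortened
   at once. *)
have Bm1 : lifts 2 (rB (- 1)) (B (- 1)).
  have h : lifts 3 (rB (- 1)) (B (- 1)).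
    exact: (lifts_new hq he (rCD _ (- 1) (- 1)) (qD (- 1)) erefl one0).
  by apply: (lifts_short h m1 hb (rAB _ (- 1) 0)) => //; apply: (@neq0 (- 2)); [ring|].
have Dm2 : lifts 2 (rD (- 2)) (D (- 2)).
  have h : lifts 4 (rD (- 2)) (D (- 2)).
    apply: (lifts_new hq Bm1 (rCB _ (- 1) (- 1)) (ram_qB charF sb rt (- 1))).
      by field.
    by apply: (@neq0 (- 1)); [field|].
  by apply: (lifts_short h m1 he (rAD _ (- 1) (- 1))) => //; apply: (@neq0 2); [ring|].
have Bm2 : lifts 2 (rB (- 2)) (B (- 2)).
  have h : lifts 4 (rB (- 2)) (B (- 2)).
    exact: (lifts_new hq Dm2 (rCD _ (- 1) (- 2)) (qD (- 2)) erefl one0).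
  by apply: (lifts_short h m2 hb (rAB _ (- 2) 0)) => //; apply: (@neq0 (- 4)); [ring|].
have Dm3 : lifts 2 (rD (- 3)) (D (- 3)).
  have h : lifts 4 (rD (- 3)) (D (- 3)).
    apply: (lifts_new hq Bm2 (rCB _ (- 1) (- 2)) (ram_qB charF sb rt (- 2))).
      by field.
    by apply: (@neq0 (- 3)); [field|].
  by apply: (lifts_short h m2 he (rAD _ (- 2) (- 1))) => //; apply: (@neq0 2); [ring|].
have Bm3 : lifts 3 (rB (- 3)) (B (- 3)).
  have h : lifts 4 (rB (- 3)) (B (- 3)).
    exact: (lifts_new hq Dm3 (rCD _ (- 1) (- 3)) (qD (- 3)) erefl one0).
  by apply: (lifts_short h m1 Bm2 (rAB _ (- 1) (- 2))) => //; apply: (@neq0 6); [ring|].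
have Dm4 : lifts 3 (rD (- 4)) (D (- 4)).
  have h : lifts 5 (rD (- 4)) (D (- 4)).
    apply: (lifts_new hq Bm3 (rCB _ (- 1) (- 3)) (ram_qB charF sb rt (- 3))).
      by field.
    by apply: (@neq0 (- 5)); [field|].
  by apply: (lifts_short h m2 Dm2 (rAD _ (- 2) (- 2))) => //; apply: (@neq0 6); [ring|].
have Cm2 : lifts 3 (rC (- 2)) (C (- 2)).
  exact: (lifts_new hb Dm2 (rBD _ 0 (- 2)) (bD (- 2)) erefl mone0).
have Cm4 : lifts 4 (rC (- 4)) (C (- 4)).
  exact: (lifts_new hb Dm4 (rBD _ 0 (- 4)) (bD (- 4)) erefl mone0).
(* The base relations for the induction on the weight. Where the bracket is 0, a lift of the vector
   with coefficient 0 is still supplied. *)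
have x0 : br d e = 0.
  by rewrite (lifts_eq hd he h0 (rDD _ 0 (- 1)) erefl) ?scale0r.
have x1 : br d (D 1) = 0.
  by rewrite (lifts_eq hd D1 a2 (rDD _ 0 1) erefl) ?scale0r.
have y1 : br (B 1) d = - C 1.
  by rewrite (lifts_eq B1 hd C1 (rBD _ 1 0) erefl) ?scaleN1r.
have y3 : br (B 1) (D 2) = - C 3.
  by rewrite (lifts_eq B1 D2 C3 (rBD _ 1 2) erefl) ?scaleN1r.
have xm1 : br e (D (- 2)) = 0.
  by rewrite (lifts_eq he Dm2 m2 (rDD _ (- 1) (- 2)) erefl) ?scale0r.
have ym1 : br (B (- 1)) e = - C (- 2).
  by rewrite (lifts_eq Bm1 he Cm2 (rBD _ (- 1) (- 1)) erefl) ?scaleN1r.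
have ym3 : br (B (- 1)) (D (- 3)) = - C (- 4).
  by rewrite (lifts_eq Bm1 Dm3 Cm4 (rBD _ (- 1) (- 3)) erefl) ?scaleN1r.
have [DDu BDu] := ram_flat_up charF sb rt x0 x1 y1 y3.
have [im im2] := sqrtN1.
have [DDd BDd] := ram_flat_down charF sb rt im2 x0 xm1 ym1 ym3.
have DD i j : br (D i) (D j) = 0.
  by case: (boolP (0 <= i + j + 1)) => h; [exact: DDu|apply: DDd; lia].
have BD i j : br (B i) (D j) = br b (D (i + j)).
  by case: (boolP (0 <= i + j)) => h; [exact: BDu|apply: BDd; lia].
split; split=> //.
- by move=> k; apply: (DD 0).
- by move=> k; apply: (DD (- 1)).
- by move=> k; have := BD k 0; rewrite addr0.
- by move=> k; apply: (BD k (- 1)).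
- exact: (lifts_uniq a1 (lifts_new hb B1 (rBB _ 0 1) (bB 1) erefl mone0)).
- exact: (lifts_uniq m1 (lifts_new hb Bm1 (rBB _ 0 (- 1)) (bB (- 1)) erefl mone0)).
- exact: (lifts_uniq a2 (lifts_new hb B2 (rBB _ 0 2) (bB 2) erefl mone0)).
- exact: (lifts_uniq m2 (lifts_new hb Bm2 (rBB _ 0 (- 2)) (bB (- 2)) erefl mone0)).
Qed.

(** The projection to the quotient factors through [phi]: its composite with [rmodel] is a
    homomorphism that agrees with the projection on the eight generators. *)
Lemma ramond_ker_gen u : phi u = 0 -> I u.
Proof.
have [mor _] := phiM.
have [[dD eD Bd Be] [g0 g1 g2 g3 g5]] := quot_flat.
have [[e0 e1 e2 e3] [e4 e5 e6 e7]] := ramond_genE.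
pose psi := @rmodel _ charF V br b d e p q.
have psi_lin c x y : psi (c *: x + y) = c *: psi x + psi y.
  exact: rmodel_linear.
have psi0 : psi 0 = 0.
  by have := psi_lin (- 1) 0 0; rewrite scaler0 addr0 scaleN1r addNr.
suff E v : pi v = psi (phi v).
  by move=> h; apply/(quot_pi_eq0 idI); rewrite E h.
elim/freeLS_ind: v => [|c x y hx hy|x y hx hy|j].
- by rewrite linear0 raddf0.
- by rewrite linearP quot_piZ psi_lin hx hy.
- rewrite mor quot_pi_lbr hx hy; apply: esym.
  exact: (rmodel_br sb rt dD eD Bd Be).
rewrite phi_gen; case: j => [[|[|[|[|[|[|[|[|n]]]]]]]] hj]; last by [].
- rewrite (val_inj (erefl : val (Ordinal hj) = val (gen 0))) e0 /psi rmodelU.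
  exact: g0.
- rewrite (val_inj (erefl : val (Ordinal hj) = val (gen 1))) e1 /psi rmodelU.
  exact: g1.
- rewrite (val_inj (erefl : val (Ordinal hj) = val (gen 2))) e2 /psi rmodelU.
  exact: g2.
- rewrite (val_inj (erefl : val (Ordinal hj) = val (gen 3))) e3 /psi rmodelU.
  exact: g3.
- rewrite (val_inj (erefl : val (Ordinal hj) = val (gen 4))) e4 /psi rmodelU.
  exact: erefl.
- rewrite (val_inj (erefl : val (Ordinal hj) = val (gen 5))) e5 /psi rmodelU.
  exact: g5.
- rewrite (val_inj (erefl : val (Ordinal hj) = val (gen 6))) e6 /psi rmodelU.
  exact: erefl.
- rewrite (val_inj (erefl : val (Ordinal hj) = val (gen 7))) e7 /psi rmodelU.
  exact: erefl.
Qed.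

End Quotient.
End Presentation.

Theorem theorem6p1 (F : fieldType) (charF : [pchar F] =i pred0)
    (sqrtN1 : exists i : F, i ^+ 2 = -1) :
  exists phi : {linear freeLS F gen_par -> KRamond charF},
    [/\ ls_morphism phi,
        forall j : 'I_8, phi (fgen F gen_par j) = ramond_gen charF j,
        forall y : KRamond charF, exists u, phi u = y &
        forall u : freeLS F gen_par,
          phi u = 0 <->
          ideal_gen
            (fun v => phi v = 0 /\ degree_le (fgen F gen_par) 5 v) u].
Proof.
have [phi [phiM phi_gen]] := freeLS_lift (@ramond_gen_homog F charF).
exists phi; split=> //; first exact: ramond_surj.
(* One direction treats each ideal containing the relations separately; the other takes the kernel
   as such an ideal. *)
move=> u; split=> [h I idI I5|h].
  have [im im2] := sqrtN1; have sqrtN1' : exists i : F, i * i = - 1.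
    by exists im; rewrite -expr2.
  by apply: (ramond_ker_gen sqrtN1' phiM phi_gen idI _ h) => v h0 h5; apply: I5.
by apply: (h (fun u => phi u = 0)) => [|v [] //]; apply: ramond_ker_ideal.
Qed.
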